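(* Let $X$ be an abelian Polish group. Then $X$ is non-locally-compact if and only if it contains a closed weakly Haar-null set.
   Context: $P(X)$ denotes the space of all Borel probability measures on $X$, equipped with the weak topology (convergence against bounded continuous real functions), which makes it a Polish space. A universally measurable set $A\subseteq X$ is called Haar-null if there exists $\mu\in P(X)$ such that $\mu(x+A)=0$ for every $x\in X$ (measures are extended to universally measurable sets via completion). For a universally measurable set $A\subseteq X$ put $T(A)=\{\mu\in P(X):\mu(x+A)=0 \text{ for every } x\in X\}$. An analytic Haar-null set $A\subseteq X$ is called strongly Haar-null if $T(A)$ is co-meager in $P(X)$; otherwise (i.e. $A$ is analytic Haar-null and $T(A)$ is not co-meager) it is called weakly Haar-null. *)

(* Defs.v *)
From HB Require Import structures.
From mathcomp Require Import all_boot all_order all_algebra.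
From mathcomp Require Import all_classical all_reals all_analysis.
From mathcomp Require Import measurable_realfun.

Set Implicit Arguments.
Unset Strict Implicit.
Unset Printing Implicit Defensive.

Import Order.TTheory GRing.Theory Num.Theory.
Import numFieldNormedType.Exports.

Local Open Scope classical_set_scope.
Local Open Scope ring_scope.

Definition nowhere_dense (T : topologicalType) (A : set T) :=
  interior (closure A) = set0.

Definition meager (T : topologicalType) (A : set T) :=
  exists2 F : (set T)^nat,
    forall n, nowhere_dense (F n) & A = \bigcup_n F n.

Definition comeager (T : topologicalType) (A : set T) := meager (~` A).

Definition is_metric (R : realType) (T : Type) (d : T -> T -> R) :=
  [/\ forall x y, 0 <= d x y,
      forall x y, d x y = 0 <-> x = y,
      forall x y, d x y = d y x &
      forall x y z, d x z <= d x y + d y z].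

Definition metrizes (R : realType) (T : topologicalType) (d : T -> T -> R) :=
  forall x : T, nbhs x =
    filter_from [set e : R | 0 < e] (fun e => [set y | d x y < e]).

Definition cauchy_seq (R : realType) (T : Type) (d : T -> T -> R)
    (u : nat -> T) :=
  forall e : R, 0 < e -> exists N : nat, forall m n : nat,
    (N <= m)%N -> (N <= n)%N -> d (u m) (u n) < e.

(* The metric is existentially quantified: only the topology of [T] is given. *)
Definition polish (R : realType) (T : topologicalType) :=
  (exists2 D : set T, countable D & dense D) /\
  (exists d : T -> T -> R,
    [/\ is_metric d, metrizes d &
        forall u : nat -> T, cauchy_seq d u -> exists l : T, u @ \oo --> l]).

(* [Y] may be empty, so [set0] is analytic. *)
Definition analytic (R : realType) (T : topologicalType) (A : set T) :=
  exists (Y : topologicalType) (f : Y -> T),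
    [/\ polish R Y, continuous f & range f = A].

(* [measurableType]s are pointed, hence the choice of [0] as base point. *)
Definition group_pointed (X : topologicalZmodType) : Type := X.

HB.instance Definition _ (X : topologicalZmodType) :=
  Choice.on (group_pointed X).
HB.instance Definition _ (X : topologicalZmodType) :=
  isPointed.Build (group_pointed X) (0 : X).

Definition borel (X : topologicalZmodType) :=
  g_sigma_algebraType (@open X : set (set (group_pointed X))).

HB.instance Definition _ (X : topologicalZmodType) := Measurable.on (borel X).

Definition bounded_continuous (R : realType) (X : topologicalZmodType) : Type :=
  {f : X -> R | continuous f /\ bounded_fun f}.

(* A [probability] is a function on all sets, constrained only on measurable
   ones. Fixing its value elsewhere makes two elements of [borel_measures] equal
   as soon as they agree on Borel sets. *)
Definition borel_measures (R : realType) (X : topologicalZmodType) :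
    set (probability (borel X) R) :=
  [set mu | forall B : set (borel X), ~ measurable B -> mu B = 0%E].
Arguments borel_measures : clear implicits.

(* The coarsest topology making [mu |-> \int[mu]_x f x] continuous for every
   bounded continuous [f]. *)
Definition borel_prob (R : realType) (X : topologicalZmodType) : Type :=
  sup_topology (fun f : bounded_continuous R X =>
    Topological.class (initial_topology
      (fun mu : borel_measures R X => \int[val mu]_x (sval f x)))).

HB.instance Definition _ (R : realType) (X : topologicalZmodType) :=
  Topological.on (borel_prob R X).

Definition borel_prob_measure (R : realType) (X : topologicalZmodType)
    (mu : borel_prob R X) : probability (borel X) R :=
  val (mu : borel_measures R X).

Coercion borel_prob_measure : borel_prob >-> probability.

Definition universally_measurable (R : realType) (X : topologicalZmodType)
    (A : set X) :=
  forall mu : borel_prob R X, completed_algebra_gen mu (A : set (borel X)).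

(* [completion mu A] is [mu B] for any decomposition of [A] as [B `|` N] with
   [B] Borel and [N] [mu]-negligible; it is a junk value for those [A] that
   have no such decomposition. *)
Definition completion (R : realType) (X : topologicalZmodType)
    (mu : probability (borel X) R) (A : set (borel X)) : \bar R :=
  mu (xget set0 [set B | measurable B /\
                         exists2 N, mu.-negligible N & B `|` N = A]).

Lemma completionE (R : realType) (X : topologicalZmodType)
    (mu : probability (borel X) R) (B N : set (borel X)) :
  measurable B -> mu.-negligible N -> completion mu (B `|` N) = mu B.
Proof.
move=> mB nN; rewrite /completion; case: xgetP => [C _ [mC [M nM CMBN]]|].
  have le_mu (D E P : set (borel X)) : measurable D -> measurable E ->
      mu.-negligible P -> D `<=` E `|` P -> (mu D <= mu E)%E.
    move=> mD mE [Q [mQ Q0 PQ]] DEP; apply: (@le_trans _ _ (mu (E `|` Q))).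
      rewrite le_measure ?inE//; first exact: measurableU.
      by move=> x /DEP[Ex|/PQ Qx]; [left|right].
    by rewrite measureU0.
  apply/eqP; rewrite eq_le (le_mu C B N)//=; last by rewrite -CMBN; left.
  by apply: (le_mu B C M) => //; rewrite CMBN; left.
by move=> /(_ B) /not_andP[//|/forall2NP/(_ N)[|]//].
Qed.

Definition witness_measures (R : realType) (X : topologicalZmodType)
    (A : set X) : set (borel_prob R X) :=
  [set mu | forall x : X, completion mu [set x + a | a in A] = 0%E].

Definition haar_null (R : realType) (X : topologicalZmodType) (A : set X) :=
  universally_measurable R A /\ exists mu : borel_prob R X, witness_measures A mu.

Definition strongly_haar_null (R : realType) (X : topologicalZmodType)
    (A : set X) :=
  [/\ analytic R A, haar_null R A & comeager (@witness_measures R X A)].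

Definition weakly_haar_null (R : realType) (X : topologicalZmodType)
    (A : set X) :=
  [/\ analytic R A, haar_null R A & ~ comeager (@witness_measures R X A)].

(* Main.v *)
From HB Require Import structures.
Require Import Defs.
From mathcomp Require Import all_boot all_order all_algebra.
From mathcomp Require Import all_classical all_reals all_analysis.
From mathcomp Require Import measurable_realfun.
From mathcomp Require Import ring lra zify.

Set Implicit Arguments.
Unset Strict Implicit.
Unset Printing Implicit Defensive.

Import Order.TTheory GRing.Theory Num.Theory.
Import numFieldNormedType.Exports.

Local Open Scope classical_set_scope.
Local Open Scope ring_scope.

(** Throughout, a witness of a set A is a probability measure that vanishes on
    all translates of A.  The weak neighbourhoods of a finitely supported measure
    are easy to describe, and such measures are dense; they are handled as laws
    of simple random variables on the unit interval.

    If X is locally compact, let A be closed with a witness m.  Moving m close to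
    0 by countably many translations of pieces of X keeps it a witness, and its
    convolution with any finitely supported law p is then a witness close to p;
    so the witnesses are dense ([dense_witness]).  The mass of a translate x + A
    is upper semicontinuous in the measure, uniformly for x in a compact set, and
    X is a countable union of compact sets; so the witnesses form a G-delta set
    and are comeager ([locally_compact_comeager]).

    Suppose that X is not locally compact.  The group uniformity of a Polish group
    is complete ([polish_group_complete]), so a neighbourhood of 0 is never
    totally bounded, and there is a base V of neighbourhoods of 0 in which no
    [V n] is covered by finitely many translates of [V n.+1].  Infinitely many
    shifts in [V n] can thus be chosen far apart at scale [n.+1], even modulo
    finite sets.  A sequence of such shifts, each small with respect to the
    preceding choices, codes an arbitrary sequence of finite sets of a dense
    countable set together with their small neighbourhoods.  The closed set A
    consists of the points that follow some code ([coded]).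

    There is a witness of A: the law of a random series [sum_i digit_i h_i]
    ([spread_rv]).  It lives on a totally bounded set, so any translate of A
    meets this set in points of one single code; and it gives little mass to a
    small neighbourhood of a finite set, if the neighbourhood is chosen after the
    size of the set ([spread_witness]).  On the other hand, most measures are
    concentrated, at every scale, near one of the finite sets available at that
    scale, since finitely supported measures are dense; the limit of the
    corresponding shifts is a translation that puts most of the mass of such a
    measure into A ([concentrated_not_witness]).  So the witnesses are contained
    in a meager set.

    This set is not comeager as well, because the space of probability measures
    is a Baire space ([borel_prob_baire]).  Given dense open sets, one builds
    simple random variables with laws in them; two simple random variables with
    close laws can be coupled so as to be close off a small set ([coupling]), so
    the sequence can be made to converge in probability. *)

(** * Topological abelian groups and their completeness *)

(** Identities in an abelian group are decided by comparing the integer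
    coefficients of the atoms on both sides. *)
Inductive zexpr :=
  | ZVar of nat | ZZero | ZAdd of zexpr & zexpr | ZOpp of zexpr.

Fixpoint zeval (G : zmodType) (env : seq G) e : G :=
  match e with
  | ZVar n => env`_n
  | ZZero => 0
  | ZAdd e1 e2 => zeval env e1 + zeval env e2
  | ZOpp e1 => - zeval env e1
  end.

Fixpoint zcoef e (n : nat) : int :=
  match e with
  | ZVar m => (m == n)%:R
  | ZZero => 0
  | ZAdd e1 e2 => zcoef e1 n + zcoef e2 n
  | ZOpp e1 => - zcoef e1 n
  end.

Lemma zevalE (G : zmodType) (env : seq G) e :
  zeval env e = \sum_(i < size env) env`_i *~ zcoef e i.
Proof.
elim: e => /= [n||e1 -> e2 ->|e ->].
- have [nlt|nge] := ltnP n (size env).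
    rewrite (bigD1 (Ordinal nlt)) //= eqxx mulr1z big1 ?addr0// => i ni.
    by rewrite eq_sym; move: ni; rewrite -val_eqE /= => /negbTE ->; rewrite mulr0z.
  rewrite nth_default// big1// => i _.
  by rewrite gtn_eqF ?mulr0z// (leq_trans (ltn_ord i)).
- by rewrite big1// => i _; rewrite mulr0z.
- by rewrite -big_split; apply: eq_bigr => i _; rewrite mulrzDr.
- by rewrite -sumrN; apply: eq_bigr => i _; rewrite mulrNz.
Qed.

Lemma zeval_eq (G : zmodType) (env : seq G) e1 e2 :
  all (fun i => zcoef e1 i == zcoef e2 i) (iota 0 (size env)) ->
  zeval env e1 = zeval env e2.
Proof.
move=> /allP h; rewrite !zevalE; apply: eq_bigr => i _.
by congr (_ *~ _); apply/eqP/h; rewrite mem_iota /= add0n ltn_ord.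
Qed.

Ltac zatom t l l0 :=
  lazymatch l with
  | [::] => constr:(t :: l0)
  | t :: _ => l0
  | _ :: ?l' => zatom t l' l0
  end.
Ltac zatoms t l :=
  lazymatch t with
  | ?a + ?b => let l := zatoms a l in zatoms b l
  | - ?a => zatoms a l
  | 0 => l
  | _ => zatom t l l
  end.
Ltac zindex t l :=
  lazymatch l with
  | t :: _ => constr:(0%N)
  | _ :: ?l' => let n := zindex t l' in constr:(S n)
  end.
Ltac zquote t l :=
  lazymatch t with
  | ?a + ?b =>
      let a := zquote a l in let b := zquote b l in constr:(ZAdd a b)
  | - ?a => let a := zquote a l in constr:(ZOpp a)
  | 0 => constr:(ZZero)
  | _ => let n := zindex t l in constr:(ZVar n)
  end.
Ltac zmod :=
  lazymatch goal with
  | |- @eq ?T ?s ?t =>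
      let l := zatoms s (@nil T) in let l := zatoms t l in
      let s := zquote s l in let t := zquote t l in
      exact: (@zeval_eq _ l s t erefl)
  end.

Section group_topology.
Variable X : topologicalZmodType.
Implicit Types (x y : X) (U V W A : set X).

Lemma nbhs_translate a x U : nbhs (a + x) U -> nbhs x [set y | U (a + y)].
Proof.
move=> nU.
have : continuous (fun y : X => a + y).
  move=> y; apply: (@continuous_comp _ _ _ (fun z => (a, z))
    (fun z : X * X => z.1 + z.2)); last exact: add_continuous.
  by apply: cvg_pair; [exact: cvg_cst|exact: cvg_id].
by move=> /(_ x) /(_ U nU).
Qed.

Lemma group_nbhs0P x U : nbhs x U <-> nbhs 0 [set y | U (x + y)].
Proof.
split=> nU; first by apply: nbhs_translate; rewrite addr0.
have : nbhs x [set y | U (x + (- x + y))].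
  by apply: (@nbhs_translate _ _ [set y | U (x + y)]); rewrite addNr.
by apply: filterS => y; rewrite /= addrA subrr add0r.
Qed.

Lemma nbhs0D U : nbhs 0 U ->
  exists2 V, nbhs 0 V & forall x y, V x -> V y -> U (x + y).
Proof.
move=> nU; have /= := @add_continuous X (0, 0) U.
rewrite /= addr0 => /(_ nU) [[A B] /= [nA nB] ABU].
exists (A `&` B); first exact: filterI.
by move=> x y [Ax _] [_ By]; exact: (ABU (x, y)).
Qed.

Lemma nbhs0N U : nbhs 0 U -> nbhs 0 [set x | U (- x)].
Proof. by move=> nU; have /= := @opp_continuous X 0 U; rewrite oppr0; apply. Qed.

Lemma nbhs0_symmetric U : nbhs 0 U -> exists2 V, nbhs 0 V &
  V `<=` U /\ forall x, V x -> V (- x).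
Proof.
move=> nU; exists (U `&` [set x | U (- x)]).
  by apply: filterI => //; exact: nbhs0N.
by split=> [x []//|x [Ux UNx]]; split=> //=; rewrite opprK.
Qed.

(** A point of the closure of a neighbourhood V is a sum of two elements of V,
    when V is symmetric; hence small closed neighbourhoods exist. *)
Lemma nbhs0_closed U : nbhs 0 U -> exists V,
  [/\ nbhs 0 V, closed V, forall x, V x -> V (- x) &
      forall x y, V x -> V y -> U (x + y)].
Proof.
move=> /nbhs0D[W1 nW1 W1U]; have /nbhs0D[W2 nW2 W2W1] := nW1.
have [W3 nW3 [W32 W3N]] := nbhs0_symmetric nW2.
have cW3 : closure W3 `<=` W1.
  move=> x /(_ [set y | W3 (- x + y)])[].
    by apply: nbhs_translate; rewrite addNr.
  move=> y [W3y /= /W3N]; rewrite opprD opprK => W3xy.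
  rewrite -(subrK y x); apply: W2W1; exact: W32.
exists (closure W3); split.
- by apply: filterS nW3; exact: subset_closure.
- exact: closed_closure.
- move=> x cx B nB; have : nbhs x [set y | B (- y)].
    by have /= := @opp_continuous X x B; apply.
  by move=> /cx[y [W3y /= By]]; exists (- y); split=> //; exact: W3N.
- by move=> x y /cW3 ? /cW3 ?; exact: W1U.
Qed.

Definition group_base (V : nat -> set X) :=
  [/\ forall n, nbhs 0 (V n), forall n, closed (V n),
      forall n x, V n x -> V n (- x),
      forall n x y, V n.+1 x -> V n.+1 y -> V n (x + y) &
      forall U, nbhs 0 U -> exists n, V n `<=` U].

Lemma subr_cvg0 (u : nat -> X) l :
  u @ \oo --> l <-> (fun n => u n - l) @ \oo --> (0 : X).
Proof.
split=> ul U nU; rewrite /nbhs/=.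
  have /ul : nbhs l [set y | U (- l + y)].
    by apply: (@nbhs_translate (- l) l U); rewrite addNr.
  by apply: (@filterS _ \oo) => n /=; rewrite addrC.
move/group_nbhs0P : nU => /ul; apply: (@filterS _ \oo) => n /=.
by rewrite addrCA subrr addr0.
Qed.

Section base_theory.
Variable V : nat -> set X.
Hypothesis bV : group_base V.

Lemma base0 n : V n 0.
Proof. by have [nV _ _ _ _] := bV; exact: nbhs_singleton. Qed.

Lemma base_nbhs n : nbhs 0 (V n). Proof. by have [] := bV. Qed.

Lemma base_closed n : closed (V n). Proof. by have [] := bV. Qed.

Lemma base_opp n x : V n x -> V n (- x). Proof. by have [_ _ + _ _] := bV; apply. Qed.

Lemma base_add n x y : V n.+1 x -> V n.+1 y -> V n (x + y).
Proof. by have [_ _ _ + _] := bV; apply. Qed.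

Lemma base_sub n x y : V n.+1 x -> V n.+1 y -> V n (x - y).
Proof. by move=> Vx Vy; apply: base_add => //; exact: base_opp. Qed.

Lemma base_mono m n : (m <= n)%N -> V n `<=` V m.
Proof.
move=> /subnK <-; elim: (n - m)%N => // k IHk x.
rewrite addSn => Vx; apply: IHk.
by rewrite -[x]addr0; apply: base_add => //; exact: base0.
Qed.

Lemma base_small U : nbhs 0 U -> exists n, V n `<=` U.
Proof. by have [_ _ _ _] := bV; apply. Qed.

Lemma base_nbhsx x n : nbhs x [set y | V n (y - x)].
Proof.
apply/group_nbhs0P; apply: filterS (base_nbhs n) => y /=.
by rewrite addrAC subrr add0r.
Qed.

Lemma base_nbhs_sub x U : nbhs x U -> exists n, forall y, V n (y - x) -> U y.
Proof.
move=> /group_nbhs0P/base_small[n VU]; exists n => y /VU /=.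
by rewrite addrCA subrr addr0.
Qed.

Lemma base_closure A x : (forall n, exists2 a, A a & V n (a - x)) -> closure A x.
Proof.
move=> h U /base_nbhs_sub[n VU]; have [a Aa Va] := h n.
by exists a; split=> //; exact: VU.
Qed.

Lemma base_translate_closed a n : closed [set y | V n (y - a)].
Proof.
move=> x cx; apply: base_closed => U nU.
have : nbhs x [set y | U (- a + y)].
  by apply: nbhs_translate; rewrite addrC.
by move=> /cx[y [/= Vy Uy]]; exists (y - a); split=> //; rewrite addrC.
Qed.

(** Geometric control: the halving property of the base bounds sums of any
    length whose k-th term lies in the (n + k + 1)-st neighbourhood. *)
Lemma base_sum (x : nat -> X) n k :
  (forall i, V (n + i).+1 (x i)) -> V n (\sum_(i < k) x i).
Proof.
elim: k n x => [|k IHk] n x Vx; first by rewrite big_ord0; exact: base0.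
rewrite big_ord_recl /=; apply: base_add.
  by have := Vx 0%N; rewrite addn0.
apply: (IHk _ (fun i => x i.+1)) => i; have := Vx i.+1.
by rewrite addnS addSn.
Qed.

End base_theory.
End group_topology.

Section polish_group.
Variables (R : realType) (X : topologicalZmodType).

Lemma metrizes_nbhs (d : X -> X -> R) x e : metrizes d -> 0 < e ->
  nbhs x [set y | d x y < e].
Proof. by move=> md e0; rewrite md; exists e. Qed.

(** The base is built one member at a time.  The relation Q serves to record, for
    groups that are not locally compact, that no member is covered by finitely
    many translates of the next one. *)
Lemma group_base_refined (Q : set X -> set X -> Prop) : polish R X ->
  (forall U, nbhs 0 U -> exists2 W, nbhs 0 W &
    forall W', nbhs 0 W' -> W' `<=` W -> Q U W') ->
  exists2 V, group_base V & forall n, Q (V n) (V n.+1).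
Proof.
move=> [_ [d [dm md _]]] hQ.
pose B (n : nat) : set X := [set y | d 0 y < n.+1%:R^-1].
have nB n : nbhs 0 (B n).
  by apply: metrizes_nbhs => //; rewrite invr_gt0 ltr0n.
have step (U : set X) (n : nat) : exists W : set X, nbhs 0 U ->
    [/\ nbhs 0 W, closed W, forall x, W x -> W (- x),
      forall x y, W x -> W y -> U (x + y) & W `<=` B n /\ Q U W].
  have [nU|nU] := pselect (nbhs 0 U); last by exists set0.
  have [W nW WQ] := hQ _ nU.
  have /nbhs0_closed[W' [nW' cW' NW' DW']] : nbhs 0 (U `&` B n `&` W).
    by apply: filterI => //; apply: filterI.
  have sub : W' `<=` U `&` B n `&` W.
    by move=> x W'x; rewrite -[x]addr0; apply: DW' => //; exact: nbhs_singleton.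
  exists W' => _; split=> // [x y Wx Wy|]; first by have [[]] := DW' _ _ Wx Wy.
  split; first by move=> x /sub[[]].
  by apply: WQ => // x /sub[].
pose f U n := projT1 (cid (step U n)).
have fP U n : nbhs 0 U -> _ := projT2 (cid (step U n)).
pose V := fix V (n : nat) : set X :=
  if n is n'.+1 then f (V n') n'.+1 else f setT 0%N.
have VS n : V n.+1 = f (V n) n.+1 by [].
have nV n : nbhs 0 (V n).
  elim: n => [|n IHn]; first by have [] := fP setT 0%N filterT.
  by rewrite VS; have [] := fP _ n.+1 IHn.
have VB n : V n `<=` B n.
  case: n => [|n]; first by have [_ _ _ _ []] := fP setT 0%N filterT.
  by rewrite VS; have [_ _ _ _ []] := fP _ n.+1 (nV n).
exists V; last by move=> n; rewrite VS; have [_ _ _ _ []] := fP _ n.+1 (nV n).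
split=> //.
- case=> [|n]; first by have [] := fP setT 0%N filterT.
  by rewrite VS; have [] := fP _ n.+1 (nV n).
- case=> [|n]; first by have [] := fP setT 0%N filterT.
  by rewrite VS; have [] := fP _ n.+1 (nV n).
- by move=> n; rewrite VS; have [] := fP _ n.+1 (nV n).
- move=> U; rewrite md => -[e /= e0 eU].
  exists (Num.trunc e^-1) => x /VB /= xe; apply: eU => /=.
  apply: lt_le_trans xe _; rewrite -[leRHS]invrK lef_pV2 ?posrE ?invr_gt0//.
  by apply/ltW/truncnS_gt.
Qed.

Lemma exists_group_base : polish R X -> exists V : nat -> set X, group_base V.
Proof.
move=> hX; have [|V bV _] := @group_base_refined (fun _ _ => True) hX.
  by move=> U nU; exists setT; [exact: filterT|].
by exists V.
Qed.

Lemma polish_hausdorff : polish R X -> hausdorff_space X.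
Proof.
move=> [_ [d [[d0 d1 dC dT] md _]]] x y xy; apply/(d1 x y)/eqP.
rewrite eq_le d0 andbT; apply/ler_addgt0Pl => e e0; rewrite addr0.
have e2 : 0 < e / 2 by rewrite divr_gt0.
have [z [/= xz yz]] := xy _ _ (metrizes_nbhs x md e2) (metrizes_nbhs y md e2).
by have := dT x z y; rewrite (dC z y); lra.
Qed.

Lemma base_eq0 (V : nat -> set X) x : polish R X -> group_base V ->
  (forall n, V n x) -> x = 0.
Proof.
move=> /polish_hausdorff hX bV Vx; apply: hX => A B nA nB.
have [n VA] := base_nbhs_sub bV nA.
exists 0; split; last exact: nbhs_singleton.
by apply: VA; rewrite sub0r; exact: (base_opp bV).
Qed.

(** Klee's theorem.  As the complete metric d need not be invariant, a Cauchy
    sequence [s] of the group uniformity need not be d-Cauchy.  But some translate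
    of it is: points [x k] are perturbed along increments of [s], so that the
    translates [x k + s n] are eventually trapped in sets of small d-diameter, and
    the limit of [x] is the required translation. *)
Lemma polish_group_complete (V : nat -> set X) (s : nat -> X) :
  polish R X -> group_base V ->
  (forall k, exists N, forall m n, (N <= m)%N -> (N <= n)%N -> V k (s m - s n)) ->
  exists l : X, s @ \oo --> l.
Proof.
move=> [_ [d [dm md dc]]] bV sC; have [d0 d1 dC dT] := dm.
pose r (k : nat) : R := k.+1%:R^-1.
have r0 k : 0 < r k by rewrite invr_gt0 ltr0n.
(* in a state (x, m, N) the set x + V m is small for d, and so is the union of
   its translates by the s n with n >= N *)
pose small (k : nat) (p : X * nat * nat) :=
  let: (x, m, N) := p in
  (forall u, V m u -> d x (x + u) < r k) /\
  exists c, forall n u, (N <= n)%N -> V m u -> d c (x + u + s n) < r k.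
have step (p : X * nat * nat) k : exists q : X * nat * nat,
    small k q /\ exists2 w, V p.1.2.+1 w & q.1.1 = p.1.1 + w /\ (p.1.2 < q.1.2)%N.
  case: p => [[x m] N] /=; have [N0 sN0] := sC m.+1.
  have := metrizes_nbhs (x + s N0) md (r0 k).
  move=> /(base_nbhs_sub bV)[a aP].
  have [N1 sN1] := sC a.+1; pose N2 := maxn N0 N1.
  pose x' := x - (s N2 - s N0).
  have := metrizes_nbhs x' md (r0 k).
  move=> /(base_nbhs_sub bV)[b bP].
  exists (x', maxn (maxn a.+1 b) m.+1, N2); split; first split.
  - move=> u Vu; apply: bP; rewrite addrAC subrr add0r.
    by apply: (base_mono bV) Vu; lia.
  - exists (x + s N0) => n u Nn Vu; apply: aP.
    rewrite (_ : _ - _ = u + (s n - s N2)); last by rewrite /x'; zmod.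
    apply: (base_add bV); first by apply: (base_mono bV) Vu; lia.
    by apply: sN1; lia.
  - exists (- (s N2 - s N0)); last by split=> //=; lia.
    by apply: (base_opp bV); apply: sN0; lia.
pose next p k := projT1 (cid (step p k)).
have nextP p k := projT2 (cid (step p k)).
pose st := fix st (k : nat) : X * nat * nat :=
  if k is k'.+1 then next (st k') k else next (0, 0%N, 0%N) 0%N.
pose x k := (st k).1.1; pose m k := (st k).1.2; pose N k := (st k).2.
have stP k : small k (x k, m k, N k).
  have eta q : small k q -> small k (q.1.1, q.1.2, q.2) by case: q => [[]].
  apply: eta; case: k => [|k]; first by have [] := nextP (0, 0%N, 0%N) 0%N.
  by have [] := nextP (st k) k.+1.
have xS k : exists2 w, V (m k).+1 w & x k.+1 = x k + w.
  by have [_ [w Vw [xw _]]] := nextP (st k) k.+1; exists w.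
have mS k : (m k < m k.+1)%N by have [_ [w Vw [_ ?]]] := nextP (st k) k.+1.
have mD k j : (m k + j <= m (k + j))%N.
  elim: j => [|j IHj]; first by rewrite !addn0.
  by rewrite !addnS; apply: leq_ltn_trans (mS _).
pose w k := projT1 (cid2 (xS k)).
have wV k : V (m k).+1 (w k) by rewrite /w; case: (cid2 _).
have xw k : x k.+1 = x k + w k by rewrite /w; case: (cid2 _).
have xD k j : V (m k) (x (k + j)%N - x k).
  rewrite (_ : _ - _ = \sum_(i < j) w (k + i)%N).
    apply: (base_sum bV (x := fun i => w (k + i)%N)) => i; apply: (base_mono bV) (wV _).
    by rewrite ltnS.
  elim: j => [|j IHj]; first by rewrite addn0 subrr big_ord0.
  by rewrite big_ord_recr /= -IHj addnS xw; zmod.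
have [y xy] : exists y : X, x @ \oo --> y.
  apply: dc => e e0.
  pose k := Num.trunc (2 / e).
  have rk : r k < e / 2.
    rewrite -[ltRHS]invrK ltf_pV2 ?posrE ?invr_gt0 ?divr_gt0 ?ltr0n//.
    by rewrite invf_div truncnS_gt.
  exists k => i j ki kj; have [stk _] := stP k.
  have small_ n : (k <= n)%N -> d (x k) (x n) < r k.
    move=> kn; rewrite -(subnKC kn) -[x (k + _)%N](subrK (x k)) addrC.
    by apply: stk; exact: xD.
  have := dT (x i) (x k) (x j); rewrite (dC (x i) (x k)).
  by have := small_ _ ki; have := small_ _ kj; lra.
have yV k : V (m k) (y - x k).
  have cl := base_translate_closed bV (a := x k) (n := m k).
  apply: (@closed_cvg _ X \oo _ x [set z | V (m k) (z - x k)] cl _ y xy).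
  by exists k => // n /= kn; rewrite -(subnKC kn); exact: xD.
have [l yl] : exists l : X, (fun n => y + s n) @ \oo --> l.
  apply: dc => e e0.
  pose k := Num.trunc (2 / e).
  have rk : r k < e / 2.
    rewrite -[ltRHS]invrK ltf_pV2 ?posrE ?invr_gt0 ?divr_gt0 ?ltr0n//.
    by rewrite invf_div truncnS_gt.
  have [_ [c cP]] := stP k.
  exists (N k) => i j ki kj.
  have := cP _ _ ki (yV k); have := cP _ _ kj (yV k).
  rewrite [x k + _]addrC subrK.
  by have := dT (y + s i) c (y + s j); rewrite (dC (y + s i) c); lra.
exists (l - y); apply/subr_cvg0; move/subr_cvg0 : yl.
by rewrite (_ : (fun n => s n - (l - y)) = fun n => y + s n - l)//;
  apply/funext => n; zmod.
Qed.

End polish_group.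

(** * Compactness, separation and closed subspaces in Polish groups *)

Lemma ultra_bigU (T : choiceType) (S : Type) (F : set_system S) (A : T -> set S)
    (s : seq T) : UltraFilter F ->
  F (fun y => exists2 a, a \in s & A a y) -> exists2 a, a \in s & F (A a).
Proof.
move=> FU; elim: s => [|b s IHs].
  rewrite (_ : (fun _ => _) = set0); last first.
    by apply/seteqP; split=> // y [a]; rewrite in_nil.
  by move=> /filter_ex[].
move=> FA; have [Fb|Fb] := in_ultra_setVsetC (A b) FU.
  by exists b => //; rewrite mem_head.
have [|a sa FAa] := IHs.
  apply: filterS2 FA Fb => y [a + Aay] Aby; rewrite inE => /orP[/eqP ab|].
    by case: Aby; rewrite -ab.
  by move=> sa; exists a.
by exists a => //; rewrite inE sa orbT.
Qed.

Section polish_topology.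
Variables (R : realType) (X : topologicalZmodType).
Hypothesis hX : polish R X.

Definition covered (U W : set X) :=
  exists s : seq X, forall y, U y -> exists2 a, a \in s & W (y - a).

(** An ultrafilter selects a small translate at every scale; points common to
    more and more of these form a Cauchy sequence, and the uniformity is
    complete. *)
Lemma totally_bounded_compact U :
  (forall W, nbhs 0 W -> covered U W) -> compact (closure U).
Proof.
move=> cU; have [V bV] := exists_group_base hX.
have {}cU n : covered (closure U) (V n).
  have [s sP] := cU _ (base_nbhs bV n.+1); exists s => y cy.
  have [u [Uu /= Vu]] := cy _ (base_nbhsx bV y n.+1).
  have [a sa Va] := sP _ Uu; exists a => //.
  rewrite (_ : y - a = (u - a) - (u - y)); last by zmod.
  exact: (base_sub bV).
rewrite compact_ultra => F FU Fc.
have /choice[a aP] n : exists a, F [set y | V n (y - a)].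
  have [s sP] := cU n.
  have [|a _ Fa] := @ultra_bigU _ _ F (fun a => [set y | V n (y - a)]) s FU.
    exact: filterS Fc.
  by exists a.
have /choice[s sP] n : exists y, forall i, (i <= n)%N -> V i (y - a i).
  suff : F (fun y => forall i, (i <= n)%N -> V i (y - a i)).
    by move=> /filter_ex[y yP]; exists y.
  elim: n => [|n IHn].
    by apply: filterS (aP 0%N) => y /= V0 i; rewrite leqn0 => /eqP ->.
  apply: filterS2 IHn (aP n.+1) => y /= yP Vy i.
  by rewrite leq_eqVlt => /predU1P[->//|]; exact: yP.
have [|l sl] := @polish_group_complete R X V s hX bV.
  move=> k; exists k.+1 => m n km kn.
  rewrite (_ : s m - s n = (s m - a k.+1) - (s n - a k.+1)); last by zmod.
  by apply: (base_sub bV); exact: sP.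
have lV n : V n (l - a n).
  have cl := base_translate_closed bV (a := a n) (n := n).
  apply: (@closed_cvg _ X \oo _ s [set z | V n (z - a n)] cl _ l sl).
  by exists n => // m /= nm; exact: sP.
have Fl : F --> l.
  move=> W /(base_nbhs_sub bV)[n VW]; apply: filterS (aP n.+1) => y /= Vy.
  apply: VW; rewrite (_ : y - l = (y - a n.+1) - (l - a n.+1)); last by zmod.
  exact: (base_sub bV).
exists l; split=> //; apply: closed_closure => W /Fl FW.
by have [y []] := filter_ex (filterI Fc FW); exists y.
Qed.

Lemma translate_continuous (a : X) : continuous (fun y : X => a + y).
Proof.
move=> y W /= nW; exact: (@nbhs_translate X a y W).
Qed.

Lemma not_locally_compact_covered : ~ locally_compact [set: X] ->
  forall U, nbhs 0 U -> exists2 W, nbhs 0 W & ~ covered U W.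
Proof.
move=> nlc U nU; apply: contrapT => h; apply: nlc => x _.
have cU : compact (closure U).
  by apply: totally_bounded_compact => W nW; apply: contrapT => ?; apply: h; exists W.
exists ((fun y => x + y) @` closure U).
  suff : nbhs x ((fun y => x + y) @` closure U) by apply: filterS.
  by apply/group_nbhs0P; apply: filterS nU => y Uy; exists y => //; exact: subset_closure.
have cpt : compact ((fun y => x + y) @` closure U).
  apply: continuous_compact => //; apply: continuous_subspaceT.
  exact: translate_continuous.
by split=> //; apply: compact_closed => //; exact: polish_hausdorff hX.
Qed.

Lemma dense_sequence :
  exists q : nat -> X, forall (x : X) U, nbhs x U -> exists n, U (q n).
Proof.
have [[D /countable_injP[f finj] dD] _] := hX.
have [q qP] : exists q : nat -> X, forall x, D x -> exists n, q n = x.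
  have /choice[q qP] : forall n, exists y : X, forall x, D x -> f x = n -> y = x.
    move=> n; have [[x [Dx fx]]|h] := pselect (exists x, D x /\ f x = n).
      exists x => y Dy fy; apply: finj; rewrite ?inE//.
      by rewrite fx fy.
    by exists 0 => x Dx fx; case: h; exists x.
  by exists q => x Dx; exists (f x); exact: qP.
exists q => x U; rewrite nbhsE => -[W [oW Wx] WU].
have [|y [Wy Dy]] := dD W _ oW; first by exists x.
by have [n qn] := qP _ Dy; exists n; apply: WU; rewrite qn.
Qed.

Lemma locally_compact_sigma : locally_compact [set: X] ->
  exists2 L : nat -> set X, forall n, compact (L n) & forall x, exists n, L n x.
Proof.
move=> lc; have [K + [cK _]] := lc 0 I; rewrite /within /= => nK.
have {nK} : nbhs (0 : X) K by apply: filterS nK => x; apply.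
move=> /nbhs0_symmetric[W nW [WK WN]].
have [q qd] := dense_sequence.
exists (fun n => (fun y => q n + y) @` K) => [n|x].
  apply: continuous_compact => //; apply: continuous_subspaceT.
  exact: translate_continuous.
have [|n qn] := qd x [set y | W (y - x)].
  by apply/group_nbhs0P; apply: filterS nW => y /=; rewrite addrAC subrr add0r.
exists n; exists (x - q n); last by rewrite addrCA subrr addr0.
by apply: WK; rewrite -opprB; exact: WN.
Qed.

Lemma polish_lipschitz_continuous (d : X -> X -> R) (g : X -> R) :
  metrizes d -> (forall x y, `|g x - g y| <= d x y) -> continuous g.
Proof.
move=> md gd x; apply/cvgrPdist_lt => e e0.
by apply: filterS (metrizes_nbhs x md e0) => y /=; exact: le_lt_trans.
Qed.

(** The function is the distance to C for a compatible metric. *)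
Lemma closed_zero_set (C : set X) : closed C -> C !=set0 ->
  exists g : X -> R,
    [/\ continuous g, forall x, 0 <= g x & forall x, g x = 0 <-> C x].
Proof.
move=> cC [c0 Cc0]; have [_ [d [[d0 d1 dC dT] md _]]] := hX.
pose g x := inf [set d x c | c in C].
have lb x : has_lbound [set d x c | c in C] by exists 0 => _ [c _ <-].
have g_le x c : C c -> g x <= d x c by move=> Cc; apply: ge_inf => //; exists c.
have le_g x r : (forall c, C c -> r <= d x c) -> r <= g x.
  move=> h; apply: lb_le_inf; first by exists (d x c0); exists c0.
  by move=> _ [c Cc <-]; exact: h.
have gD x y : g x - g y <= d x y.
  rewrite lerBlDl -lerBlDr; apply: le_g => c Cc.
  by rewrite lerBlDr addrC; apply: le_trans (dT x y c); exact: g_le.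
exists g; split.
- apply: polish_lipschitz_continuous md _ => x y.
  by rewrite ler_norml lerNl opprB gD dC gD.
- by move=> x; exact: le_g.
- move=> x; split=> [gx0|Cx]; last first.
    apply/eqP; rewrite eq_le le_g//= andbT.
    by apply: le_trans (g_le x x Cx) _; rewrite (d1 x x).2.
  apply: cC => U; rewrite md => -[e /= e0 eU].
  apply: contrapT => h; have : e <= g x; last by rewrite gx0 leNgt e0.
  apply: le_g => c Cc; rewrite leNgt; apply/negP => dxc.
  by apply: h; exists c; split=> //; exact: eU.
Qed.

Lemma separating_function (C D : set X) : closed C -> closed D ->
  (forall x, C x -> ~ D x) -> exists f : X -> R,
  [/\ continuous f, forall x, 0 <= f x <= 1, forall x, C x -> f x = 1 &
      forall x, D x -> f x = 0].
Proof.
move=> cC cD CD.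
have [->|/set0P C0] := eqVneq C set0.
  by exists (fun=> 0); split=> // [|x]; [exact: cst_continuous|rewrite lexx ler01].
have [->|/set0P D0] := eqVneq D set0.
  by exists (fun=> 1); split=> // [|x]; [exact: cst_continuous|rewrite ler01 lexx].
have [g [gc g0 gC]] := closed_zero_set cC C0.
have [h [hc h0 hD]] := closed_zero_set cD D0.
have gh0 x : 0 < g x + h x.
  rewrite lt_neqAle addr_ge0// andbT eq_sym paddr_eq0//.
  by apply/negP => /andP[/eqP /gC Cx /eqP /hD]; exact: CD.
exists (fun x => h x / (g x + h x)); split.
- move=> x; apply: cvgM; first exact: hc.
  apply: cvgV; first by rewrite gt_eqF.
  by apply: cvgD; [exact: gc|exact: hc].
- move=> x; rewrite divr_ge0 ?(ltW (gh0 x))//=.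
  by rewrite ler_pdivrMr// mul1r lerDr.
- by move=> x Cx; rewrite (gC x).2// add0r divff// -[h x]add0r -{1}((gC x).2 Cx) gt_eqF.
- by move=> x Dx; rewrite (hD x).2// mul0r.
Qed.

(** The Polish space that maps onto A is A itself, as a subspace. *)
Lemma closed_analytic (A : set X) : closed A -> analytic R A.
Proof.
move=> cA; have [_ [d [[d0 d1 dC dT] md dc]]] := hX.
have [q qd] := dense_sequence.
have nbhsA (x : set_type A) U : nbhs x U <->
    exists2 W, nbhs (set_val x) W & set_val @^-1` W `<=` U.
  split=> [|[W nW WU]].
    rewrite nbhsE => -[B [[W oW WB] Bx] BU].
    exists W; last by rewrite WB.
    by apply: open_nbhs_nbhs; split=> //; move: Bx; rewrite -WB.
  apply: filterS WU _; move: nW; rewrite nbhsE => -[W' [oW' W'x] W'W].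
  rewrite nbhsE; exists (set_val @^-1` W'); last by move=> y /W'W.
  by split=> //; exists W'.
exists (set_type A), set_val; split; last 2 first.
- by move=> x U nU; apply/nbhsA; exists U.
- apply/seteqP; split=> [_ [x _ <-]|x Ax]; first exact: set_valP.
  by exists (SigSub (mem_set Ax)).
split; last first.
  exists (fun x y => d (set_val x) (set_val y)); split.
  - split; [by move=> x y; exact: d0| |by move=> x y; exact: dC|by move=> x y z; exact: dT].
    by move=> x y; split=> [/d1/val_inj|->]; last exact: (d1 _ _).2.
  - move=> x; apply/seteqP; split=> U.
      move=> /nbhsA[W]; rewrite md => -[e /= e0 eW] WU.
      by exists e => // y /= xy; apply: WU; exact: eW.
    move=> [e /= e0 eU]; apply/nbhsA; exists [set y | d (set_val x) y < e].
      exact: metrizes_nbhs.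
    by move=> y /= xy; exact: eU.
  - move=> u /dc[l ul]; have Al : A l.
      apply: cA => W /ul[N _ NW]; exists (set_val (u N)).
      by split; [exact: set_valP|exact: (NW N (leqnn N))].
    exists (SigSub (mem_set Al)) => U /nbhsA[W nW WU].
    by have := ul _ nW; apply: (@filterS _ \oo) => n /= ?; exact: WU.
pose near_q (p : nat * nat) (y : set_type A) := d (q p.1) (set_val y) < p.2.+1%:R^-1.
have /choice[g gP] (p : nat * nat) : exists z : option (set_type A),
    forall y, near_q p y -> exists2 z', z = Some z' & near_q p z'.
  have [[y py]|h] := pselect (exists y, near_q p y).
    by exists (Some y) => y' _; exists y.
  by exists None => y py; case: h; exists y.
exists [set y | exists p, g p = Some y].
  rewrite -(eq_countable (inj_card_eq (f := Some) _)); last by move=> ? ? _ _ [].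
  apply: (@sub_countable _ _ _ (range g)); last first.
    exact: card_le_trans (card_image_le _ _) (countableP _).
  by apply: subset_card_le => _ [y [p pE] <-]; exists p.
move=> U [x Ux] oU; have /nbhsA[W] : nbhs x U by exact: open_nbhs_nbhs.
rewrite md => -[e /= e0 eW] WU.
pose k := Num.trunc (2 / e).
have rk : k.+1%:R^-1 < e / 2.
  rewrite -[ltRHS]invrK ltf_pV2 ?posrE ?invr_gt0 ?divr_gt0 ?ltr0n//.
  by rewrite invf_div truncnS_gt.
have [|n qn] := qd (set_val x) [set y | d (set_val x) y < k.+1%:R^-1].
  by apply: metrizes_nbhs => //; rewrite invr_gt0 ltr0n.
have [|z gz qz] := gP (n, k) x; first by rewrite /near_q /= dC.
exists z; split; last by exists (n, k).
apply: WU; apply: eW => /=; move: qn qz; rewrite /near_q /= => qn qz.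
apply: (le_lt_trans (dT _ (q n) _)).
by rewrite (splitr e) ltrD//; [exact: lt_trans qn rk|exact: lt_trans qz rk].
Qed.

End polish_topology.

(** * The weak topology on probability measures *)

Section borel_prob_theory.
Variables (R : realType) (X : topologicalZmodType).
Implicit Types (mu nu : borel_prob R X) (f : bounded_continuous R X).

Section cutoff.
Variable m : probability (borel X) R.

(** Changing a measure outside the Borel sets makes it an element of the space
    of measures. *)
Definition cutoff (B : set (borel X)) : \bar R :=
  if `[< measurable B >] then m B else 0%E.

Lemma cutoffE B : measurable B -> cutoff B = m B.
Proof. by move=> mB; rewrite /cutoff asboolT. Qed.

Let cutoff0 : cutoff set0 = 0%E. Proof. by rewrite cutoffE// measure0. Qed.

Let cutoff_ge0 B : (0 <= cutoff B)%E.
Proof. by rewrite /cutoff; case: ifPn. Qed.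

Let cutoff_sigma_additive : semi_sigma_additive cutoff.
Proof.
move=> F mF tF mUF; rewrite cutoffE//.
rewrite (_ : (fun n => _) = fun n => \sum_(0 <= i < n) m (F i))%E.
  exact: measure_semi_sigma_additive.
by apply/funext => n; apply: eq_bigr => i _; rewrite cutoffE.
Qed.

HB.instance Definition _ := isMeasure.Build _ _ _ cutoff
  cutoff0 cutoff_ge0 cutoff_sigma_additive.

Let cutoffT : cutoff setT = 1%E.
Proof. by rewrite cutoffE// probability_setT. Qed.

HB.instance Definition _ := Measure_isProbability.Build _ _ _ cutoff cutoffT.

Definition cutoff_prob : probability (borel X) R := cutoff.

Lemma cutoff_borel_measures : borel_measures R X cutoff_prob.
Proof. by move=> B mB; rewrite /= /cutoff asboolF. Qed.

Definition to_borel_prob : borel_prob R X :=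
  SigSub (mem_set cutoff_borel_measures) : borel_measures R X.

Lemma to_borel_probE B : measurable B -> to_borel_prob B = m B.
Proof. exact: cutoffE. Qed.

End cutoff.

Lemma open_borel (U : set X) : open U -> measurable (U : set (borel X)).
Proof. by move=> oU; exact: sub_sigma_algebra. Qed.

Lemma closed_borel (C : set X) : closed C -> measurable (C : set (borel X)).
Proof.
by move=> cC; rewrite -(setCK C); apply: measurableC; apply: open_borel; exact: closed_openC.
Qed.

Lemma continuous_borel (f : X -> R) : continuous f ->
  measurable_fun setT (f : borel X -> R).
Proof.
move=> cf; apply: (measurability _ (RGenOpens.measurableE R)).
move=> _ [_ [a [b ->] <-]]; rewrite setTI; apply: open_borel.
by move/continuousP : cf; apply; exact: interval_open.
Qed.

Lemma bounded_continuous_bound f : exists2 M, 0 < M & forall x, `|sval f x| <= M.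
Proof.
case: f => f [cf [M [_ Mf]]] /=; exists (`|M| + 1); first by rewrite ltr_wpDl.
move=> x; apply: Mf => //.
by apply: le_lt_trans (ler_norm M) _; rewrite ltrDl.
Qed.

Lemma bounded_continuous_cont f : continuous (sval f).
Proof. by case: f => f []. Qed.

Lemma make_bounded_continuous (g : X -> R) (M : R) : continuous g ->
  (forall x, `|g x| <= M) -> exists f, sval f = g.
Proof.
move=> cg gM; suff h : continuous g /\ bounded_fun g by exists (exist _ g h).
split=> //; exists M; split; first exact: num_real.
by move=> N MN x _; apply: le_trans (gM x) (ltW MN).
Qed.

Lemma bounded_continuous_integrable f d (T : measurableType d)
    (P : probability T R) (phi : T -> borel X) : measurable_fun setT phi ->
  P.-integrable setT (EFin \o (sval f \o phi)).
Proof.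
move=> mphi; apply: measurable_bounded_integrable => //.
- by rewrite -ge0_fin_numE// fin_num_measure.
- apply: measurableT_comp => //; apply: continuous_borel.
  exact: bounded_continuous_cont.
- have [M M0 fM] := bounded_continuous_bound f.
  exists M; split; first exact: num_real.
  by move=> N MN x _; apply: le_trans (fM _) (ltW MN).
Qed.

Lemma expectation_continuous f :
  continuous (fun mu : borel_prob R X => \int[mu]_x sval f x).
Proof.
move=> mu.
have /cvg_sup/(_ f) h : nbhs mu --> mu by exact: cvg_id.
move=> U nU; apply: h.
exact: (@initial_continuous _ _ (fun nu : borel_measures R X =>
  \int[val nu]_x sval f x)).
Qed.

Lemma expectation_gt f mu c : c < \int[mu]_x sval f x ->
  nbhs mu [set nu : borel_prob R X | c < \int[nu]_x sval f x].
Proof.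
by move=> cf; exact: (cvgr_gt _ (@expectation_continuous f mu) _ cf).
Qed.

Lemma expectation_lt f mu c : \int[mu]_x sval f x < c ->
  nbhs mu [set nu : borel_prob R X | \int[nu]_x sval f x < c].
Proof.
by move=> cf; exact: (cvgr_lt _ (@expectation_continuous f mu) _ cf).
Qed.

(** The neighbourhoods given by finitely many test functions form a filter; it
    converges to mu for each of the initial topologies, hence for their
    supremum. *)
Lemma weak_nbhs mu (W : set (borel_prob R X)) : nbhs mu W ->
  exists n (f : nat -> bounded_continuous R X) (e : R), 0 < e /\
  forall nu, (forall i, (i < n)%N ->
    `|\int[nu]_x sval (f i) x - \int[mu]_x sval (f i) x| < e) -> W nu.
Proof.
pose basic : set_system (borel_prob R X) := fun W =>
  exists n (f : nat -> bounded_continuous R X) (e : R), 0 < e /\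
  forall nu, (forall i, (i < n)%N ->
    `|\int[nu]_x sval (f i) x - \int[mu]_x sval (f i) x| < e) -> W nu.
have [f0 _] := @make_bounded_continuous (fun=> 0) 0 (@cst_continuous _ _ _)
  (fun _ => ltac:(by rewrite normr0)).
have Fbasic : Filter basic.
  split.
  - by exists 0%N, (fun=> f0), 1.
  - move=> U1 U2 [n1 [f1 [e1 [e10 h1]]]] [n2 [f2 [e2 [e20 h2]]]].
    exists (n1 + n2)%N, (fun i => if (i < n1)%N then f1 i else f2 (i - n1)%N).
    exists (Num.min e1 e2); split; first by rewrite lt_min e10.
    move=> nu h; split.
      apply: h1 => i i1; have := h i (ltn_addr _ i1); rewrite i1.
      by move=> /lt_le_trans; apply; rewrite ge_min lexx.
    apply: h2 => i i2; have := h (n1 + i)%N; rewrite ltn_add2l => /(_ i2).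
    rewrite ltnNge leq_addr /= addKn.
    by move=> /lt_le_trans; apply; rewrite ge_min lexx orbT.
  - move=> U1 U2 U12 [n [f [e [e0 h]]]].
    by exists n, f, e; split=> // nu /h /U12.
suff : basic `=>` nbhs mu by move=> /(_ W).
apply/cvg_sup => f U /=.
rewrite (@nbhsE (initial_topology (fun nu : borel_measures R X =>
  \int[val nu]_x sval f x))) => -[B [[C oC CB] Bmu] BU].
have : nbhs (\int[mu]_x sval f x) C.
  by apply: open_nbhs_nbhs; split=> //; move: Bmu; rewrite -CB.
move=> /nbhs_ballP[e /= e0 eC].
exists 1%N, (fun=> f), e; split=> // nu /(_ 0%N erefl) h.
by apply: BU; rewrite -CB; apply: eC; rewrite /ball /= distrC.
Qed.

Section law.
Context d (T : measurableType d) (P : probability T R) (phi : T -> borel X).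
Hypothesis mphi : measurable_fun setT phi.

Let mphi_mixin := isMeasurableFun.Build _ _ _ _ _ mphi.
Let phi_pack := MeasurableFun.Pack (MeasurableFun.Class mphi_mixin).

Definition law : borel_prob R X := to_borel_prob (distribution P phi_pack).

Lemma lawE B : measurable B -> law B = P (phi @^-1` B).
Proof. by move=> mB; rewrite /law to_borel_probE. Qed.

Lemma integral_law f : \int[law]_x sval f x = \int[P]_t sval f (phi t).
Proof.
rewrite /Rintegral; congr fine.
rewrite (@eq_measure_integral _ _ _ _ (distribution P phi_pack)); last first.
  by move=> A mA _; exact: lawE.
rewrite integral_distribution//.
  apply/measurable_EFinP; have cf := bounded_continuous_cont (f := f).
  exact: continuous_borel.
exact: bounded_continuous_integrable.
Qed.

End law.

End borel_prob_theory.

(** * Random variables and their laws *)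

Lemma exprV2_small (R : realType) (e : R) : 0 < e ->
  exists n, (2^-1 : R) ^+ n <= e.
Proof.
move=> e0; have := @cvg_expr R 2^-1; rewrite ger0_norm ?invr_ge0// invf_lt1// ltr1n.
move=> /(_ erefl)/(cvgr_lt _)/(_ _ e0)[n _ /(_ n (leqnn n))] /= h.
by exists n; exact: ltW.
Qed.

Section random_variables.
Variables (R : realType) (X : topologicalZmodType).

Definition pr d (T : measurableType d) (P : probability T R) (A : set T) : R :=
  fine (P A).

Section pr_theory.
Context d (T : measurableType d) (P : probability T R).
Implicit Types A B : set T.

Lemma prE A : measurable A -> P A = (pr P A)%:E.
Proof. by move=> mA; rewrite /pr fineK// fin_num_measure. Qed.

Lemma pr_ge0 A : 0 <= pr P A.
Proof. by rewrite /pr fine_ge0. Qed.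

Lemma prT : pr P setT = 1.
Proof. by rewrite /pr probability_setT. Qed.

Lemma pr0 : pr P set0 = 0.
Proof. by rewrite /pr measure0. Qed.

Lemma pr_le A B : measurable A -> measurable B -> A `<=` B -> pr P A <= pr P B.
Proof.
move=> mA mB AB; rewrite -lee_fin -!prE//.
by apply: le_measure; rewrite ?inE.
Qed.

Lemma pr_split A B : measurable A -> measurable B ->
  pr P A = pr P (A `&` B) + pr P (A `&` ~` B).
Proof.
move=> mA mB; apply: EFin_inj; rewrite EFinD -!prE//.
- by rewrite (measureDI _ mA mB) addeC setDE.
- by apply: measurableI => //; exact: measurableC.
- exact: measurableI.
Qed.

Lemma prC A : measurable A -> pr P (~` A) = 1 - pr P A.
Proof. by move=> mA; rewrite -prT (pr_split measurableT mA) !setTI addrAC subrr add0r. Qed.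

End pr_theory.

Definition simple_rv d (T : measurableType d) (phi : T -> X) :=
  (forall B : set X, measurable (phi @^-1` B)) /\
  exists s : seq X, forall t, phi t \in s.

(** The exceptional set N makes this meaningful without any measurability of the
    difference of phi and chi. *)
Definition close_rv d (T : measurableType d) (P : probability T R)
    (phi : T -> X) (W : set X) (r : R) (chi : T -> X) :=
  exists2 N : set T, measurable N /\ pr P N <= r &
    forall t, ~ N t -> W (chi t - phi t).

Section general_space.
Context d (T : measurableType d) (P : probability T R).

Lemma simple_measurable (phi : T -> X) : simple_rv phi ->
  measurable_fun setT (phi : T -> borel X).
Proof. by move=> [mphi _] _ B mB; rewrite setTI; exact: mphi. Qed.

Lemma measurable_rv (phi : T -> borel X) :
  (forall C : set X, closed C -> measurable (phi @^-1` C)) ->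
  measurable_fun setT phi.
Proof.
move=> h; apply: (@measurability _ _ _ _ _ _ (@open X : set (set (borel X)))) => //.
move=> _ [U oU <-]; rewrite setTI -[X in measurable X]setCK.
by apply: measurableC; rewrite preimage_setC; apply: h; exact: open_closedC.
Qed.

(** Closed sets are zero sets of continuous functions, which reduces the
    measurability of a pointwise limit to the real-valued case. *)
Lemma measurable_rv_limit (phi : nat -> T -> borel X) (psi : T -> borel X) :
  polish R X -> (forall n, measurable_fun setT (phi n)) ->
  (forall t, (fun n => phi n t : X) @ \oo --> (psi t : X)) ->
  measurable_fun setT psi.
Proof.
move=> hX mphi phipsi; apply: measurable_rv => C cC.
have [->|/set0P C0] := eqVneq C set0; first by rewrite preimage_set0.
have [g [gc g0 gC]] := closed_zero_set hX cC C0.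
have mg : measurable_fun setT (g \o psi).
  apply: (@measurable_fun_cvg _ _ _ setT (fun n => g \o phi n)).
    by move=> n; apply: measurableT_comp => //; exact: continuous_borel.
  by move=> t _; apply: continuous_cvg; [exact: gc|exact: phipsi].
rewrite (_ : psi @^-1` C = (g \o psi) @^-1` [set 0]); last first.
  by apply/seteqP; split=> t /=; rewrite gC.
by rewrite -[X in measurable X]setTI; exact: mg.
Qed.

Lemma simple_prob (I : choiceType) (phi : T -> I) (s : seq I) (E : set T)
    (B : set I) :
  (forall B : set I, measurable (phi @^-1` B)) -> uniq s -> measurable E ->
  (forall t, E t -> phi t \in s) ->
  pr P (E `&` phi @^-1` B) =
    \sum_(b <- s | b \in B) pr P (E `&` phi @^-1` [set b]).
Proof.
move=> mphi; elim: s E => [|b s IHs] E /=.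
  move=> _ mE Es; rewrite big_nil (_ : E = set0) ?set0I ?pr0//.
  by apply/seteqP; split=> // t /Es.
move=> /andP[bs us] mE Es; pose E' := E `&` ~` (phi @^-1` [set b]).
have mE' : measurable E' by apply: measurableI => //; exact: measurableC.
have E's t : E' t -> phi t \in s.
  by move=> [/Es + tb]; rewrite inE => /orP[/eqP|//].
have restE c : c \in s -> E' `&` phi @^-1` [set c] = E `&` phi @^-1` [set c].
  move=> cs; apply/seteqP; split=> t /=; first by move=> [[]].
  by move=> [Et tc]; split=> //; split=> // tb; move: bs; rewrite -tb tc cs.
rewrite (pr_split _ (measurableI _ _ mE (mphi B)) (mphi [set b])).
rewrite [X in _ + pr P X](_ : _ = E' `&` phi @^-1` B); last first.
  by rewrite /E' -!setIA [in RHS](setIC (~` _)).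
rewrite IHs// big_cons.
rewrite [X in _ + X](_ : _ = \sum_(c <- s | c \in B)
    pr P (E `&` phi @^-1` [set c])); last first.
  rewrite big_seq_cond [RHS]big_seq_cond; apply: eq_bigr => c /andP[cs _].
  by rewrite restE.
case: ifPn => bB.
  congr (pr _ _ + _); apply/seteqP; split=> t /=; first by case=> [[]].
  by move=> [Et ->]; split=> //; split=> //; exact: set_mem.
rewrite (_ : _ `&` _ = set0) ?pr0 ?add0r//; apply/seteqP; split=> // t /= [[_ + tb]].
by rewrite tb => /mem_set; rewrite (negbTE bB).
Qed.

Lemma eq_integral_measure (f : bounded_continuous R X)
    (mu nu : probability (borel X) R) :
  (forall B, measurable B -> mu B = nu B) ->
  \int[mu]_x sval f x = \int[nu]_x sval f x.
Proof.
by move=> h; rewrite /Rintegral; congr fine; apply: eq_measure_integral => A mA _; exact: h.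
Qed.

(** The weak topology sees a measure only through its integrals. *)
Lemma eq_law_open (O : set (borel_prob R X)) (mu nu : borel_prob R X) :
  open O -> (forall B, measurable B -> mu B = nu B) -> O mu -> O nu.
Proof.
move=> oO munu Omu; have /weak_nbhs[n [f [e [e0]]]] : nbhs mu O.
  by apply: open_nbhs_nbhs; split.
by apply=> i _; rewrite (eq_integral_measure (f i) munu) subrr normr0.
Qed.

Lemma integral_le_pr (f : bounded_continuous R X) (phi : T -> borel X)
    (B : set T) :
  measurable_fun setT phi -> measurable B -> (forall x, 0 <= sval f x <= 1) ->
  (forall t, ~ B t -> sval f (phi t) = 0) ->
  \int[P]_t sval f (phi t) <= pr P B.
Proof.
move=> mphi mB f01 f0.
rewrite (_ : pr P B = \int[P]_t \1_B t); last first.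
  by rewrite /Rintegral integral_indic// setIT.
apply: le_Rintegral => //.
- exact: bounded_continuous_integrable.
- exact: integrable_indic.
move=> t _; rewrite indicE; have [_|tB] := boolP (t \in B).
  by have /andP[] := f01 (phi t).
by rewrite f0// => Bt; move/negP : tB; apply; exact: mem_set.
Qed.

Lemma pr_le_integral (f : bounded_continuous R X) (phi : T -> borel X)
    (B : set T) :
  measurable_fun setT phi -> measurable B -> (forall x, 0 <= sval f x <= 1) ->
  (forall t, B t -> sval f (phi t) = 1) ->
  pr P B <= \int[P]_t sval f (phi t).
Proof.
move=> mphi mB f01 f1.
rewrite (_ : pr P B = \int[P]_t \1_B t); last first.
  by rewrite /Rintegral integral_indic// setIT.
apply: le_Rintegral => //.
- exact: integrable_indic.
- exact: bounded_continuous_integrable.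
move=> t _; rewrite indicE; have [/set_mem Bt|_] := boolP (t \in B).
  by rewrite f1.
by have /andP[] := f01 (phi t).
Qed.

Lemma integral_bound (f : bounded_continuous R X) (phi chi : T -> borel X)
    (e M : R) (N : set T) :
  measurable_fun setT phi -> measurable_fun setT chi -> 
  measurable N -> 0 <= e -> 0 <= M ->
  (forall t, ~ N t -> `|sval f (phi t) - sval f (chi t)| <= e) ->
  (forall x, `|sval f x| <= M) ->
  `|\int[P]_t sval f (phi t) - \int[P]_t sval f (chi t)| <= e + 2 * M * pr P N.
Proof.
move=> mphi mchi mN e0 M0 fe fM.
have iphi := bounded_continuous_integrable f P mphi.
have ichi := bounded_continuous_integrable f P mchi.
rewrite -RintegralB//.
have iB : P.-integrable setT (EFin \o (fun t => sval f (phi t) - sval f (chi t))).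
  by apply: eq_integrable (integrableB _ iphi ichi).
have i1 : P.-integrable setT (EFin \o cst e) by exact: finite_measure_integrable_cst.
have i2 : P.-integrable setT (EFin \o (fun t => 2 * M * \1_N t)).
  have := integrableZl measurableT (2 * M) (integrable_indic P mN).
  by apply: eq_integrable.
apply: le_trans (le_normr_Rintegral _ iB) _ => //.
apply: (@le_trans _ _ (\int[P]_t (e + 2 * M * \1_N t))).
  apply: le_Rintegral => //; first exact: integrable_norm iB.
    exact: integrableD i1 i2.
  move=> t _; rewrite indicE; have [tN|tN] := boolP (t \in N).
    rewrite mulr1; apply: le_trans (ler_normB _ _) _.
    by have := fM (phi t); have := fM (chi t); lra.
  by rewrite mulr0 addr0; apply: fe => Nt; move: tN; rewrite mem_set.
rewrite RintegralD// Rintegral_cst// RintegralZl//; last exact: integrable_indic.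
rewrite -/(pr P setT) prT mulr1 /Rintegral integral_indic// setIT.
by rewrite lexx.
Qed.

Lemma continuous_near_seq (g : X -> R) (s : seq X) (e : R) : continuous g ->
  0 < e -> exists2 W, nbhs (0 : X) W &
    forall a w, a \in s -> W w -> `|g (a + w) - g a| <= e.
Proof.
move=> cg e0; elim: s => [|b s [W nW IHs]].
  by exists setT => //; exact: filterT.
have /group_nbhs0P nb : nbhs b [set y | `|g b - g y| < e].
  by have /cvgrPdist_lt/(_ e e0) := cg b.
exists (W `&` [set y | `|g b - g (b + y)| < e]); first exact: filterI.
move=> a w + [Ww /= bw]; rewrite inE => /orP[/eqP ->|sa]; last exact: IHs.
by rewrite distrC ltW.
Qed.

(** A test function varies little near the finitely many values of psi, and the
    exceptional set contributes at most twice its probability times a bound of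
    the test function. *)
Lemma law_stable (psi : T -> X) (U : set (borel_prob R X))
    (mpsi : measurable_fun setT (psi : T -> borel X)) :
  simple_rv psi -> nbhs (law P mpsi) U ->
  exists W r, [/\ nbhs (0 : X) W, 0 < r &
    forall (chi : T -> borel X) (mchi : measurable_fun setT chi),
      close_rv P psi W r chi -> U (law P mchi)].
Proof.
move=> [_ [s psis]] /weak_nbhs[n [f [e [e0 fU]]]].
suff [W [r [nW r0 h]]] : exists W r, [/\ nbhs (0 : X) W, 0 < r &
    forall i (chi : T -> borel X), (i < n)%N -> measurable_fun setT chi ->
      close_rv P psi W r chi ->
      `|\int[P]_t sval (f i) (chi t) - \int[P]_t sval (f i) (psi t)| < e].
  exists W, r; split=> // chi mchi chic.
  by apply: fU => i ni; rewrite !integral_law; exact: h.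
elim: n {fU} => [|n [W [r [nW r0 IHn]]]].
  by exists setT, 1; split=> //; exact: filterT.
have [M M0 fM] := bounded_continuous_bound (f n).
have e2 : 0 < e / 2 by rewrite divr_gt0.
have [W' nW' fW'] :=
  continuous_near_seq s (bounded_continuous_cont (f := f n)) e2.
exists (W `&` W'), (Num.min r (e / (8 * M))); split; first exact: filterI.
  by rewrite lt_min r0 divr_gt0// mulr_gt0.
move=> i chi; rewrite ltnS leq_eqVlt => /predU1P[->|ni] mchi [N [mN PN] chiN].
  have := @integral_bound (f n) chi psi (e / 2) M N mchi mpsi mN (ltW e2) (ltW M0).
  move=> /(_ _ fM) h; apply: le_lt_trans (h _) _.
    move=> t /chiN[_ W't]; have := fW' (psi t) _ (psis t) W't.
    by rewrite addrCA subrr addr0.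
  have : pr P N <= e / (8 * M) by apply: le_trans PN _; rewrite ge_min lexx orbT.
  rewrite ler_pdivlMr ?mulr_gt0// => ?; lra.
apply: IHn => //; exists N; last by move=> t /chiN[].
by split=> //; apply: le_trans PN _; rewrite ge_min lexx.
Qed.

(** The increments of the sequence are small off sets of summable probability,
    so that the sequence converges off a null set. *)
Lemma rv_limit (V : nat -> set X) (K : nat -> nat) (phi : nat -> T -> borel X) :
  polish R X -> group_base V -> (forall n, measurable_fun setT (phi n)) ->
  (forall n, (K n < K n.+1)%N) ->
  (forall n, close_rv P (phi n) (V (K n).+1) (2^-1 ^+ (K n).+1) (phi n.+1)) ->
  exists2 psi : T -> borel X, measurable_fun setT psi &
    forall n, close_rv P (phi n) (V (K n)) (2^-1 ^+ K n) psi.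
Proof.
move=> hX bV mphi KS phiS.
have KD n j : (K n + j <= K (n + j))%N.
  elim: j => [|j IHj]; first by rewrite !addn0.
  by rewrite !addnS; apply: leq_ltn_trans (KS _).
have /choice[N NP] n : exists N : set T, [/\ measurable N,
    pr P N <= 2^-1 ^+ (K n).+1 &
    forall t, ~ N t -> V (K n).+1 ((phi n.+1 t : X) - phi n t)].
  by have [N [mN PN] h] := phiS n; exists N.
pose bad n := \bigcup_j N (n + j)%N.
have mbad n : measurable (bad n).
  by apply: bigcup_measurable => j _; have [] := NP (n + j)%N.
pose E := \bigcup_n ~` bad n.
have mE : measurable E by apply: bigcup_measurable => n _; exact: measurableC.
pose phi' n t : borel X := if t \in E then phi n t else (0 : X).
have incr n t j : ~ bad n t -> V (K n) ((phi (n + j)%N t : X) - phi n t).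
  move=> nb; pose w i := (phi (n + i).+1 t : X) - phi (n + i)%N t.
  rewrite (_ : _ - _ = \sum_(i < j) w i).
    apply: (base_sum bV) => i; apply: (base_mono bV (n := (K (n + i)).+1)).
      by rewrite ltnS.
    by have [_ _] := NP (n + i)%N; apply=> Nt; apply: nb; exists i.
  elim: j => [|j IHj]; first by rewrite addn0 subrr big_ord0.
  by rewrite big_ord_recr /= -IHj /w -addnS; zmod.
have KV n m : (n <= K (n + m))%N.
  by have := KD 0%N (n + m)%N; rewrite add0n; lia.
have cvg_phi t : exists l : X, (fun n => phi' n t : X) @ \oo --> l.
  have [Et|Et] := boolP (t \in E); last first.
    exists 0; rewrite (_ : (fun n => _) = fun=> 0); first exact: cvg_cst.
    by apply/funext => n; rewrite /phi' (negbTE Et).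
  have [n _ nb] := set_mem Et.
  apply: (polish_group_complete hX bV) => k.
  pose N0 := (n + k.+1)%N.
  have nb0 : ~ bad N0 t by move=> [j _ Nt]; apply: nb; exists (k.+1 + j)%N => //; rewrite addnA.
  exists N0 => i j Ni Nj; rewrite /phi' Et.
  rewrite (_ : _ - _ = ((phi i t : X) - phi N0 t) - ((phi j t : X) - phi N0 t)); last by zmod.
  have kK : (k.+1 <= K N0)%N by rewrite /N0 addnC KV.
  apply: (base_sub bV); apply: (base_mono bV kK).
    by rewrite -(subnKC Ni); exact: incr.
  by rewrite -(subnKC Nj); exact: incr.
have [psi psiP] := choice cvg_phi.
exists psi.
  apply: (measurable_rv_limit hX _ psiP) => n.
  apply: measurable_rv => C cC.
  rewrite (_ : _ @^-1` _ = (E `&` phi n @^-1` C) `|` (~` E `&` (fun=> 0 : X) @^-1` C)).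
    apply: measurableU; apply: measurableI => //.
    - by rewrite -[X in measurable X]setTI; apply: mphi => //; exact: closed_borel.
    - exact: measurableC.
    - by rewrite preimage_cst; case: ifP.
  apply/seteqP; split=> t; rewrite /= /phi'.
    case: ifPn => [Et Ct|Et Ct]; first by left; split=> //; exact: set_mem.
    by right; split=> // /mem_set; rewrite (negbTE Et).
  by case=> [[/mem_set -> //]|[Et C0]]; rewrite memNset.
move=> n; exists (bad n).
  split=> //; rewrite -lee_fin -prE//.
  apply: le_trans (measure_sigma_subadditive _ _ _ (@subset_refl _ (bad n))) _ => //.
    by move=> j; have [] := NP (n + j)%N.
  apply: (@le_trans _ _ (\sum_(j <oo) (2^-1 ^+ K n / (2 ^ j.+1)%:R)%:E)%E).
    apply: lee_nneseries => // j _; have [mN PN _] := NP (n + j)%N.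
    apply: (@le_trans _ _ (pr P (N (n + j)%N))%:E); first by rewrite -prE.
    rewrite lee_fin; apply: le_trans PN _.
    rewrite natrX -exprVn -exprD.
    by apply: ler_wiXn2l; rewrite ?invr_ge0 ?invf_le1 ?ler1n// addnS ltnS.
  apply: epsilon_trick0; rewrite ?exprn_ge0 ?invr_ge0//.
move=> t nb.
have cl := base_translate_closed bV (a := phi n t : X) (n := K n).
apply: (@closed_cvg _ X \oo _ (fun n => phi' n t : X)
  [set z | V (K n) (z - (phi n t : X))] cl _ (psi t) (psiP t)).
exists n => // m /= nm; rewrite /phi' mem_set; last by exists n.
by rewrite -(subnKC nm); exact: incr.
Qed.

End general_space.
End random_variables.

(** * Simple laws on the unit interval *)

Section uniform_space.
Variable R : realType.

Definition unif : probability (measurableTypeR R) R := uniform_prob (@ltr01 R).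

Lemma unif_le_lebesgue (A : set (measurableTypeR R)) : measurable A ->
  (unif A <= lebesgue_measure (A `&` `[0%R, 1%R]))%E.
Proof.
move=> mA; rewrite /unif /= /uniform_prob integral_uniform_pdf.
have mAI : measurable (A `&` `[0%R, 1%R]) by exact: measurableI.
rewrite -[leRHS]mul1e -integral_cst//; apply: ge0_le_integral => //=.
- by move=> x _; rewrite lee_fin uniform_pdf_ge0.
- by apply/measurable_EFinP/measurable_funTS; exact: measurable_uniform_pdf.
- move=> x [_]; rewrite /= in_itv/= => x01.
  by rewrite lee_fin /uniform_pdf x01 subr0 invr1.
Qed.

Lemma unif_interval (A : set (measurableTypeR R)) (a b : R) : measurable A -> a <= b ->
  (forall x, A x -> 0 <= x <= 1 -> a <= x <= b) -> pr unif A <= b - a.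
Proof.
move=> mA ab Aab; rewrite -lee_fin -prE//.
apply: le_trans (unif_le_lebesgue mA) _.
apply: (@le_trans _ _ (lebesgue_measure `[a, b]%classic)).
  apply: le_measure; rewrite ?inE//; first exact: measurableI.
  by move=> x [Ax]; rewrite /= !in_itv/=; exact: Aab.
by rewrite lebesgue_measure_itv/= lte_fin; case: ltP => //= ?; rewrite lee_fin subr_ge0.
Qed.

(** The distribution function of a set is 1-Lipschitz, so that it takes all
    intermediate values: the uniform law has no atoms. *)
Lemma unif_split (E : set (measurableTypeR R)) (c : R) : measurable E -> 0 <= c <= pr unif E ->
  exists2 E' : set (measurableTypeR R), measurable E' /\ E' `<=` E & pr unif E' = c.
Proof.
move=> mE /andP[c0 cE].
pose F t := pr unif (E `&` `]-oo, t]).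
have mF t : measurable (E `&` `]-oo, t]) by exact: measurableI.
have F0 : F (-1) = 0.
  apply/eqP; rewrite eq_le pr_ge0 andbT -[leRHS](subrr 0).
  apply: unif_interval => // x [_]; rewrite /= in_itv/=; lra.
have F1 : F 1 = pr unif E.
  apply/eqP; rewrite eq_le pr_le//= (pr_split unif mE (measurable_itv `]-oo, 1])).
  rewrite gerDl -[leRHS](subrr 0); apply: unif_interval => //.
    by apply: measurableI => //; exact: measurableC.
  by move=> x [_]; rewrite /= in_itv/= => /negP; lra.
have Flip s t : s <= t -> `|F s - F t| <= t - s.
  move=> st; have Fst : F s <= F t.
    by apply: pr_le => // x [Ex]; rewrite /= !in_itv/= => /le_trans xs; split=> //; exact: xs.
  rewrite distrC ger0_norm ?subr_ge0// lerBlDl.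
  rewrite {1}/F (pr_split unif (mF t) (measurable_itv `]-oo, s])) lerD//.
    by apply: pr_le => //; [exact: measurableI|move=> x [[]]].
  apply: unif_interval => //; first by apply: measurableI => //; exact: measurableC.
  by move=> x [[_]]; rewrite /= !in_itv/= => ? /negP; lra.
have cF : continuous F.
  move=> x; apply/cvgrPdist_lt => e e0.
  near=> y; apply: (@le_lt_trans _ _ `|x - y|).
    have [xy|yx] := leP x y.
      by apply: le_trans (Flip _ _ xy) _; rewrite distrC ler_norm.
    by rewrite distrC; apply: le_trans (Flip _ _ (ltW yx)) _; rewrite ler_norm.
  by near: y; apply: cvgr_dist_lt e0.
have [|||t _ Ft] := @IVT R F (-1) 1 c.
- by lra.
- exact: continuous_subspaceT.
- by rewrite F0 F1 minElt maxElt; case: ltP => ?; apply/andP; split; lra.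
by exists (E `&` `]-oo, t]).
Unshelve. all: by end_near. Qed.

(** The mass of all sets of labels is recorded, so that the default label i0,
    which may be attained on a null set, needs no separate treatment. *)
Lemma unif_partition (I : choiceType) (i0 : I) (s : seq I) (c : I -> R)
    (E : set (measurableTypeR R)) : measurable E -> (forall i, i \in s -> 0 <= c i) ->
  pr unif E = \sum_(i <- s) c i ->
  exists psi : measurableTypeR R -> I, [/\ forall B : set I, measurable (psi @^-1` B),
    forall t, psi t \in i0 :: s &
    forall B : set I, pr unif (E `&` psi @^-1` B) = \sum_(i <- s | i \in B) c i].
Proof.
elim: s E => [|i s IHs] E mE c0 Ec.
  have mi (B : set I) : measurable ((fun=> i0 : I) @^-1` B : set (measurableTypeR R)).
    by rewrite preimage_cst; case: ifP.
  exists (fun=> i0); split=> // [t|B]; first by rewrite mem_head.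
  rewrite big_nil; apply/eqP; rewrite eq_le pr_ge0 andbT.
  have := Ec; rewrite big_nil => <-; apply: pr_le => //; exact: measurableI.
have sum0 : 0 <= \sum_(j <- s) c j.
  by rewrite big_seq sumr_ge0// => j js; apply: c0; rewrite inE js orbT.
have [|E' [mE' E'E] PE'] := @unif_split E (c i) mE.
  by rewrite c0 ?mem_head//= Ec big_cons lerDl.
have mD : measurable (E `&` ~` E') by apply: measurableI => //; exact: measurableC.
have EE' : E `&` E' = E' by apply/seteqP; split=> [t []//|t E't]; split=> //; exact: E'E.
have [||psi [mpsi psis psiE]] := IHs (E `&` ~` E') mD.
- by move=> j js; apply: c0; rewrite inE js orbT.
- by have := pr_split unif mE mE'; rewrite EE' Ec big_cons PE' => /addrI.
have mpsi' (B : set I) :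
    measurable ((fun t => if t \in E' then i else psi t) @^-1` B).
  rewrite (_ : _ @^-1` B = (E' `&` [set _ | B i]) `|` (~` E' `&` psi @^-1` B)).
    apply: measurableU; apply: measurableI => //; last exact: measurableC.
    have [Bi|Bi] := pselect (B i).
      by rewrite (_ : [set _ | _] = setT)//; apply/seteqP; split.
    by rewrite (_ : [set _ | _] = set0)//; apply/seteqP; split.
  apply/seteqP; split=> t /=.
    by case: ifPn => [/set_mem|/negP] tE Bt; [left|right; split=> // /mem_set].
  by case=> [[/mem_set -> //]|[tE]]; rewrite memNset.
exists (fun t => if t \in E' then i else psi t); split=> //.
  move=> t; case: ifPn => _; first by rewrite !inE eqxx orbT.
  by have := psis t; rewrite !inE => /orP[->//|->]; rewrite !orbT.
move=> B; rewrite (pr_split unif (measurableI _ _ mE (mpsi' B)) mE').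
rewrite big_cons [X in _ + pr _ X](_ : _ = E `&` ~` E' `&` psi @^-1` B).
  rewrite psiE; case: ifPn => iB.
    rewrite -PE'; congr (pr _ _ + _); apply/seteqP; split=> t /=; first by case.
    move=> E't; split=> //; split; first exact: E'E.
    by rewrite mem_set//; exact: set_mem.
  rewrite (_ : _ `&` E' = set0) ?pr0 ?add0r//; apply/seteqP; split=> // t /= [[_]].
  by move=> /[swap] /mem_set -> /mem_set; rewrite (negbTE iB).
apply/seteqP; split=> t /=; first by move=> [[Et +] nE't]; rewrite memNset.
by move=> [[Et nE't] Bt]; split=> //; split=> //; rewrite memNset.
Qed.

End uniform_space.

Section simple_laws.
Variables (R : realType) (X : topologicalZmodType).
Hypothesis hX : polish R X.
Local Notation Om := (measurableTypeR R).

(** A point is coloured by the values of the test functions, rounded to multiples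
    of e; the colours of all test functions are packed into one number. *)
Lemma oscillation_coloring (f : nat -> bounded_continuous R X) (n : nat) (e : R) :
  0 < e -> exists N (c : X -> nat), [/\ forall x, (c x < N)%N,
    forall i, measurable (c @^-1` [set i] : set (borel X)) &
    forall i x y, (i < n)%N -> c x = c y -> `|sval (f i) x - sval (f i) y| < e].
Proof.
move=> e0; elim: n => [|n [N [c [cN mc cf]]]].
  exists 1%N, (fun=> 0%N); split=> // i.
  have [->|i0] := eqVneq i 0%N; first by rewrite (_ : _ @^-1` _ = setT)//; apply/seteqP; split.
  by rewrite (_ : _ @^-1` _ = set0)//; apply/seteqP; split=> // x /= /esym /eqP; rewrite (negbTE i0).
have [M M0 fM] := bounded_continuous_bound (f n).
pose g x := (sval (f n) x + M) / e.
have g0 x : 0 <= g x.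
  by rewrite divr_ge0 ?(ltW e0)//; have := fM x; rewrite ler_norml => /andP[]; lra.
have gc : continuous g.
  move=> x; apply: cvgM; last exact: cvg_cst.
  by apply: cvgD; [exact: bounded_continuous_cont|exact: cvg_cst].
pose L := (Num.trunc (2 * M / e)).+1.
have gL x : (Num.trunc (g x) < L)%N.
  rewrite ltnS; apply: le_truncn; rewrite ler_pM2r ?invr_gt0//.
  by have := fM x; rewrite ler_norml => /andP[]; lra.
exists (N * L)%N, (fun x => c x + N * Num.trunc (g x))%N.
have N0 : (0 < N)%N by exact: leq_ltn_trans (leq0n _) (cN 0).
have cE x : ((c x + N * Num.trunc (g x)) %% N = c x)%N.
  by rewrite mulnC addnC modnMDl modn_small.
have gE x : ((c x + N * Num.trunc (g x)) %/ N = Num.trunc (g x))%N.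
  by rewrite mulnC addnC divnMDl ?N0// divn_small ?addn0.
split.
- move=> x; apply: (@leq_trans (N + N * Num.trunc (g x))%N).
    by rewrite ltn_add2r.
  by rewrite -mulnS leq_mul2l gL orbT.
- move=> i.
  have mt k : measurable ([set x | Num.trunc (g x) = k] : set (borel X)).
    rewrite (_ : [set x | _] = g @^-1` `[k%:R, k.+1%:R[).
      rewrite -[X in measurable X]setTI.
      by apply: (continuous_borel gc) => //; exact: measurable_itv.
    apply/seteqP; split=> x /=; rewrite in_itv/=.
      by move=> <-; rewrite truncn_le//= ?g0// truncnS_gt.
    by move=> gx; apply/eqP; rewrite truncn_eq.
  rewrite (_ : _ @^-1` _ = (c @^-1` [set (i %% N)%N]) `&`
      [set x | Num.trunc (g x) = (i %/ N)%N]); first exact: measurableI.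
  apply/seteqP; split=> x /=; first by move=> <-; rewrite cE gE.
  by move=> [-> ->]; rewrite addnC mulnC -divn_eq.
- move=> i x y; rewrite ltnS leq_eqVlt => /predU1P[->|ni] cxy; last first.
    by apply: cf => //; rewrite -cE cxy cE.
  have gxy : Num.trunc (g x) = Num.trunc (g y) by rewrite -gE cxy gE.
  rewrite (_ : _ - _ = (g x - g y) * e); last by rewrite /g; field; lra.
  rewrite normrM (gtr0_norm e0) gtr_pMl// ltr_norml.
  have := truncn_le (g x); have := truncn_le (g y); rewrite !g0.
  have := truncnS_gt (g x); have := truncnS_gt (g y).
  by rewrite gxy -natr1; lra.
Qed.

(** Every point is replaced by a representative of its colour class; the resulting
    finitely supported law is then realized on the unit interval. *)
Lemma simple_law_dense (nu : borel_prob R X) (U : set (borel_prob R X)) :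
  nbhs nu U -> exists (chi : Om -> X) (mchi : measurable_fun setT (chi : Om -> borel X)),
    simple_rv chi /\ U (law (unif R) mchi).
Proof.
move=> /weak_nbhs[n [f [e [e0 fU]]]].
have e2 : 0 < e / 2 by rewrite divr_gt0.
have [N [c [cN mc cf]]] := oscillation_coloring f n e2.
have mcB (B : set nat) : measurable (c @^-1` B : set (borel X)).
  rewrite (_ : _ @^-1` _ = \bigcup_(i in B) c @^-1` [set i]).
    by apply: bigcup_measurable => i _.
  by apply/seteqP; split=> [x Bx|x [i Bi /= xi]]; [exists (c x)|rewrite /= xi].
have /choice[rep repP] i : exists x : X, (exists y, c y = i) -> c x = i.
  by have [[y cy]|h] := pselect (exists y, c y = i); [exists y|exists 0].
have repc x : c (rep (c x)) = c x by apply: repP; exists x.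
pose p i := pr nu (c @^-1` [set i] : set (borel X)).
have sump (B : set nat) : pr nu (c @^-1` B : set (borel X)) =
    \sum_(i <- iota 0 N | i \in B) p i.
  have := @simple_prob R _ _ nu nat c (iota 0 N) setT B mcB (iota_uniq _ _) measurableT.
  rewrite setTI => ->; last by move=> x _; rewrite mem_iota add0n cN.
  by apply: eq_bigr => i _; rewrite setTI.
have [||psi [mpsi psis psiE]] :=
    @unif_partition R nat 0%N (iota 0 N) p setT measurableT.
- by move=> i _; exact: pr_ge0.
- rewrite prT -[LHS](prT nu) -(preimage_setT c) sump.
  by apply: eq_bigl => i; rewrite in_setT.
have mchi : measurable_fun setT (rep \o psi : Om -> borel X).
  by move=> _ B mB; rewrite setTI comp_preimage; exact: mpsi.
have mrc : measurable_fun setT (rep \o c : borel X -> borel X).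
  by move=> _ B mB; rewrite setTI comp_preimage; exact: mcB.
have mid : measurable_fun setT (idfun : borel X -> borel X) by exact: measurable_id.
exists (rep \o psi), mchi; split.
  split=> [B|]; first by rewrite comp_preimage; exact: mpsi.
  by exists (map rep (0%N :: iota 0 N)) => t; exact: (map_f rep (psis t)).
apply: fU => i ni.
rewrite (@eq_integral_measure _ _ (f i) _ (law nu mrc)); last first.
  move=> B mB; have mrB := mcB (rep @^-1` B).
  have mpB : measurable (psi @^-1` (rep @^-1` B)) by exact: mpsi.
  have := psiE (rep @^-1` B); rewrite setTI -sump => pE.
  rewrite (lawE (unif R) mchi mB) (lawE nu mrc mB).
  by rewrite (prE (unif R) mpB) (prE nu mrB) pE.
rewrite integral_law.
have := @integral_bound R X _ _ nu (f i) (rep \o c) idfun (e / 2) _ set0 mrc mid measurable0 (ltW e2).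
have [M M0 fM] := bounded_continuous_bound (f i).
move=> /(_ _ (ltW M0) _ fM); rewrite pr0 mulr0 addr0 => h.
apply: le_lt_trans (h _) _; last by lra.
by move=> x _; apply/ltW/cf => //=; rewrite repc.
Qed.
End simple_laws.

(** * Coupling and the Baire property of the space of measures *)

(** The plan keeps a fraction [1 - th] of the mass of every point within its
    neighbourhood, spreading it in proportion to [p], and couples the remaining
    mass independently. *)
Lemma transport_plan (R : realFieldType) (I : choiceType) (near : rel I)
    (s s' : seq I) (w p : I -> R) (th : R) :
  uniq s -> 0 < th < 1 ->
  (forall a, a \in s -> 0 <= w a) -> (forall b, b \in s' -> 0 <= p b) ->
  \sum_(a <- s) w a = 1 -> \sum_(b <- s') p b = 1 ->
  (forall a a' b, a \in s -> a' \in s -> near a b -> near a' b -> a = a') ->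
  (forall a, a \in s -> 0 < w a ->
    (1 - th) * w a < \sum_(b <- s' | near a b) p b) ->
  exists c : I -> I -> R,
  [/\ forall a b, a \in s -> b \in s' -> 0 <= c a b,
      forall a, a \in s -> \sum_(b <- s') c a b = w a,
      forall b, b \in s' -> \sum_(a <- s) c a b = p b &
      \sum_(a <- s) \sum_(b <- s' | ~~ near a b) c a b <= th].
Proof.
move=> us /andP[th0 th1] w0 p0 sw sp near_inj near_mass.
pose v a := \sum_(b <- s' | near a b) p b.
have v0 a : 0 <= v a by rewrite /v big_seq_cond sumr_ge0// => b /andP[? _]; exact: p0.
have wv a : a \in s -> w a / v a * v a = w a.
  move=> sa; have [wa|wa] := eqVneq (w a) 0; first by rewrite wa !mul0r.
  rewrite divfK// gt_eqF//.
  have wa0 : 0 < w a by rewrite lt_neqAle eq_sym wa w0.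
  by apply: lt_trans (near_mass _ sa wa0); rewrite mulr_gt0// subr_gt0.
have wv0 a : a \in s -> 0 <= w a / v a by move=> sa; rewrite divr_ge0// w0.
pose u b := \sum_(a <- s | near a b) w a / v a.
have u1 b : (1 - th) * u b <= 1.
  have [/hasP[a0 sa0 na0]|/hasPn nn] := boolP (has (near^~ b) s).
    have -> : u b = w a0 / v a0.
      rewrite /u big_mkcond (bigD1_seq a0)//= na0 big_seq_cond big1 ?addr0//.
      move=> a /andP[sa aa0]; case: ifP => // na.
      by rewrite (near_inj a a0 b)// eqxx in aa0.
    have [wa|wa] := eqVneq (w a0) 0; first by rewrite wa mul0r mulr0 ler01.
    have wa0 : 0 < w a0 by rewrite lt_neqAle eq_sym wa w0.
    have lt_v := near_mass _ sa0 wa0.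
    rewrite mulrA ler_pdivrMr ?mul1r; first exact: ltW.
    by apply: lt_trans lt_v; rewrite mulr_gt0// subr_gt0.
  rewrite /u big_seq_cond big_pred0 ?mulr0 ?ler01// => a.
  by apply/negP => /andP[/nn/negP].
have spu : \sum_(b <- s') p b * u b = 1.
  under eq_bigr do rewrite /u mulr_sumr big_mkcond.
  rewrite exchange_big /= -[RHS]sw big_seq [RHS]big_seq; apply: eq_bigr => a sa.
  rewrite -[RHS](wv _ sa) /v mulr_sumr [RHS]big_mkcond; apply: eq_bigr => b _.
  by case: ifP => // _; rewrite mulrC.
pose c a b := (if near a b then (1 - th) * p b * (w a / v a) else 0)
              + w a * (p b * (1 - (1 - th) * u b)).
have rest : \sum_(b <- s') p b * (1 - (1 - th) * u b) = th.
  under eq_bigr do rewrite mulrBr mulr1 mulrCA.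
  by rewrite sumrB -mulr_sumr spu sp; lra.
have rest0 b : b \in s' -> 0 <= p b * (1 - (1 - th) * u b).
  by move=> sb; rewrite mulr_ge0 ?p0// subr_ge0.
exists c; split.
- move=> a b sa sb; rewrite addr_ge0//; last by rewrite mulr_ge0 ?w0 ?rest0.
  case: ifP => // _; apply: mulr_ge0; last exact: wv0.
  by apply: mulr_ge0; [lra|exact: p0].
- move=> a sa; rewrite big_split /= -mulr_sumr rest -big_mkcond /=.
  rewrite -mulr_suml -mulr_sumr -/(v a) -mulrA [v a * _]mulrC wv//; lra.
- move=> b sb; rewrite big_split /= -mulr_suml sw mul1r -big_mkcond /=.
  by rewrite -mulr_sumr -/(u b); ring.
- have -> : \sum_(a <- s) \sum_(b <- s' | ~~ near a b) c a b =
      \sum_(a <- s) \sum_(b <- s' | ~~ near a b) w a * (p b * (1 - (1 - th) * u b)).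
    by apply: eq_bigr => a _; apply: eq_bigr => b /negbTE nab; rewrite /c nab add0r.
  apply: (@le_trans _ _ (\sum_(a <- s) w a * th)); last by rewrite -mulr_suml sw mul1r.
  rewrite big_seq [leRHS]big_seq; apply: ler_sum => a sa.
  rewrite -mulr_sumr ler_wpM2l ?w0//.
  rewrite -[leRHS]rest [leRHS](bigID (near a)) /= lerDr.
  by rewrite big_seq_cond sumr_ge0// => b /andP[/rest0].
Qed.

Section coupling.
Variables (R : realType) (X : topologicalZmodType).
Hypothesis hX : polish R X.
Local Notation Om := (measurableTypeR R).

Lemma separate_seq (s : seq X) (W : set X) : nbhs 0 W ->
  exists V : set X, [/\ nbhs 0 V, closed V, V `<=` W &
    forall a a' b, a \in s -> a' \in s -> V (b - a) -> V (b - a') -> a = a'].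
Proof.
move=> nW; have [V bV] := exists_group_base hX.
have [n0 VW] := base_small bV nW.
suff [n nP] : exists n, forall x, x \in [seq a - a' | a <- s, a' <- s] ->
    V n x -> x = 0.
  exists (V (maxn n.+1 n0)); split.
  - exact: base_nbhs.
  - exact: base_closed.
  - by apply: subset_trans VW; apply: (base_mono bV); rewrite leq_maxr.
  - move=> a a' b sa sa' Vba Vba'; apply/eqP; rewrite -subr_eq0; apply/eqP/nP.
      by apply/allpairsP; exists (a, a').
    rewrite (_ : a - a' = (b - a') - (b - a)); last by zmod.
    by apply: (base_sub bV); apply: (base_mono bV (leq_maxl n.+1 n0)).
elim: [seq _ | a <- s, a' <- s] => [|x l [n IHl]]; first by exists 0%N.
have [->|x0] := eqVneq x 0.
  by exists n => y; rewrite inE => /orP[/eqP ->//|]; exact: IHl.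
have /existsNP[m Vm] : ~ forall n, V n x.
  by move=> Vx; move/eqP : x0; apply; exact: (base_eq0 hX bV).
exists (maxn m n) => y; rewrite inE => /orP[/eqP ->|yl] Vy.
  by case: Vm; apply: (base_mono bV (leq_maxl m n)).
by apply: IHl => //; apply: (base_mono bV (leq_maxr m n)).
Qed.

(** If the law of chi is close to that of phi, it charges the disjoint
    neighbourhoods of the values of phi almost as much as phi does.  Each level
    set of phi is then partitioned as prescribed by a transport plan. *)
Lemma coupling (phi : Om -> X) (mphi : measurable_fun setT (phi : Om -> borel X))
    (W : set X) (th : R) : simple_rv phi -> nbhs 0 W -> 0 < th < 1 ->
  exists2 U : set (borel_prob R X), nbhs (law (unif R) mphi) U &
  forall (chi : Om -> X) (mchi : measurable_fun setT (chi : Om -> borel X)),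
    simple_rv chi -> U (law (unif R) mchi) ->
  exists psi : Om -> X, [/\ simple_rv psi,
    forall B, pr (unif R) (psi @^-1` B) = pr (unif R) (chi @^-1` B) &
    close_rv (unif R) phi W th psi].
Proof.
move=> [sphi [s0 phis0]] nW th01; have /andP[th0 th1] := th01.
pose s := undup s0; have us : uniq s by exact: undup_uniq.
have phis t : phi t \in s by rewrite mem_undup.
have [V [nV cV VW Vinj]] := separate_seq s nW.
pose w a := pr (unif R) (phi @^-1` [set a]).
have fP (a : X) : exists f : bounded_continuous R X,
    [/\ forall x, 0 <= sval f x <= 1, sval f a = 1 &
        forall x, ~ V (x - a) -> sval f x = 0].
  have : nbhs a [set y | V (y - a)].
    by apply/group_nbhs0P; apply: filterS nV => y Vy /=; rewrite addrAC subrr add0r.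
  rewrite nbhsE => -[G [oG Ga] GV].
  have [|||f [fc f01 f1 f0]] := @separating_function R X hX [set a] (~` G).
  - by apply: accessible_closed_set1; apply: hausdorff_accessible; exact: polish_hausdorff hX.
  - exact: open_closedC.
  - by move=> x ->.
  have [|g gE] := @make_bounded_continuous R X f 1 fc.
    by move=> x; have := f01 x; rewrite ler_norml; lra.
  exists g; rewrite gE; split=> //; first exact: f1.
  by move=> x nV'; apply: f0 => /GV.
have [f fP'] := choice fP.
exists [set nu : borel_prob R X | forall a, a \in s -> 0 < w a ->
    (1 - th) * w a < \int[nu]_x sval (f a) x].
  suff h a : nbhs (law (unif R) mphi) [set nu : borel_prob R X | 0 < w a ->
      (1 - th) * w a < \int[nu]_x sval (f a) x].
    elim: (s) => [|b l IHl]; first by apply: (@filterS _ _ _ setT) => //; exact: filterT.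
    apply: filterS2 (h b) IHl => nu hb hl a.
    by rewrite inE => /orP[/eqP ->//|]; exact: hl.
  have [wa|wa] := ltP 0 (w a); last first.
    apply: (@filterS _ _ _ setT) => //; exact: filterT.
  have : (1 - th) * w a < \int[law (unif R) mphi]_x sval (f a) x.
    apply: (@lt_le_trans _ _ (w a)); first by rewrite gtr_pMl//; lra.
    rewrite integral_law.
    have [f01 f1 _] := fP' a; apply: pr_le_integral => //.
    by move=> t /= ->.
  by move=> /expectation_gt; apply: filterS => nu ? _.
move=> chi mchi [schi [s1 chis1]] hU.
pose s' := undup s1; have us' : uniq s' by exact: undup_uniq.
have chis t : chi t \in s' by rewrite mem_undup.
pose p b := pr (unif R) (chi @^-1` [set b]).
pose near (a b : X) := `[< V (b - a) >].
have mass B : pr (unif R) (chi @^-1` B) = \sum_(b <- s' | b \in B) p b.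
  rewrite -[chi @^-1` B]setTI (@simple_prob R _ _ (unif R) _ _ s')//.
  by apply: eq_bigr => b _; rewrite setTI.
have [|||||a sa wa|c [c0 crow ccol cfar]] := @transport_plan R X near s s' w p th us th01.
- by move=> a _; exact: pr_ge0.
- by move=> b _; exact: pr_ge0.
- rewrite -[RHS](prT (unif R)) -[setT in RHS]setTI.
  rewrite -(preimage_setT phi) (@simple_prob R _ _ (unif R) _ _ s)//.
  by apply: eq_big => [a|a _]; rewrite ?in_setT ?setTI.
- rewrite -[RHS](prT (unif R)) -(preimage_setT chi) mass.
  by apply: eq_bigl => b; rewrite in_setT.
- by move=> a a' b sa sa' /asboolP Va /asboolP Va'; exact: (Vinj a a' b).
- apply: lt_le_trans (hU _ sa wa) _.
  rewrite integral_law (eq_bigl (fun b => b \in [set b | V (b - a)])); last first.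
    by move=> b; apply/idP/idP => [/asboolP|/set_mem] h; [exact: mem_set|exact/asboolP].
  rewrite -mass.
  have [f01 _ f0] := fP' a; apply: integral_le_pr => // t; exact: f0.
have /choice[psi_ psi_P] a : exists psi : Om -> X, a \in s ->
    [/\ forall B : set X, measurable (psi @^-1` B),
    forall t, psi t \in 0 :: s' &
    forall B : set X, pr (unif R) (phi @^-1` [set a] `&` psi @^-1` B) =
      \sum_(b <- s' | b \in B) c a b].
  have [sa|] := boolP (a \in s); last by exists (fun=> 0).
  have [||psi psiP] := @unif_partition R X 0 s' (c a) (phi @^-1` [set a]) (sphi _).
  - by move=> b sb; exact: c0.
  - by rewrite crow.
  by exists psi.
pose psi t := psi_ (phi t) t.
have piece B a : phi @^-1` [set a] `&` psi @^-1` B =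
    phi @^-1` [set a] `&` psi_ a @^-1` B.
  by apply/seteqP; split=> t /= [ta]; rewrite /psi ta.
(* phi takes finitely many values, so sets defined by phi and psi split into
   pieces on which phi is constant *)
have mpair (F : X -> set X) : measurable [set t | F (phi t) (psi t)].
  rewrite (_ : [set t | _] = \bigcup_(a in [set` s])
      (phi @^-1` [set a] `&` psi_ a @^-1` F a)).
    apply: fin_bigcup_measurable => // a sa; apply: measurableI => //.
    by have [] := psi_P a sa.
  apply/seteqP; split=> t; first by move=> Bt; exists (phi t) => //=; exact: phis.
  by move=> [a sa]; rewrite -piece /= => -[-> ].
have psiE (F : X -> set X) :
    pr (unif R) [set t | F (phi t) (psi t)] =
    \sum_(a <- s) \sum_(b <- s' | b \in F a) c a b.
  rewrite -[X in pr _ X]setIT -(preimage_setT phi).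
  rewrite (@simple_prob R _ _ (unif R) _ _ s)// big_mkcond /= big_seq [RHS]big_seq.
  apply: eq_bigr => a sa; rewrite in_setT.
  have [_ _ <-] := psi_P a sa.
  congr (pr _ _); rewrite -piece; apply/seteqP.
  by split=> t /= [h h']; split=> //; [rewrite -h'|rewrite h].
exists psi; split.
- split=> [B|]; first exact: (mpair (fun=> B)).
  exists (0 :: s') => t.
  by have [_ + _] := psi_P (phi t) (phis t); apply.
- move=> B; rewrite mass (psiE (fun=> B)) exchange_big /=.
  by rewrite big_seq_cond [RHS]big_seq_cond; apply: eq_bigr => b /andP[/ccol].
- exists [set t | ~ V (psi t - phi t)].
    split; first exact: (mpair (fun a => [set b | ~ V (b - a)])).
    rewrite (psiE (fun a => [set b | ~ V (b - a)])).
    apply: le_trans cfar; rewrite le_eqVlt; apply/orP; left; apply/eqP.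
    apply: eq_bigr => a _; apply: eq_bigl => b.
    by apply/idP/idP => [/set_mem h|/asboolPn h]; [exact/asboolPn|exact: mem_set].
  by move=> t /contrapT /VW.
Qed.

End coupling.

Section baire.
Variables (R : realType) (X : topologicalZmodType).
Hypothesis hX : polish R X.
Local Notation Om := (measurableTypeR R).

(** Density of O provides psi; openness of O provides the tolerance L that later
    steps have to respect. *)
Lemma simple_step (V : nat -> set X) (O : set (borel_prob R X)) (phi : Om -> X)
    (K : nat) : group_base V -> open O -> dense O -> simple_rv phi ->
  exists psi L, [/\ simple_rv psi, (K < L)%N,
    close_rv (unif R) phi (V K.+1) (2^-1 ^+ K.+1) psi &
    forall (chi : Om -> borel X) (mchi : measurable_fun setT chi),
      close_rv (unif R) psi (V L) (2^-1 ^+ L) chi -> O (law (unif R) mchi)].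
Proof.
move=> bV oO dO sphi; have mphi := simple_measurable sphi.
have th01 : 0 < (2^-1 : R) ^+ K.+1 < 1.
  by rewrite exprn_gt0 ?invr_gt0//= exprn_ilt1// ?invr_ge0// invf_lt1// ltr1n.
have [U nU UP] := coupling hX mphi sphi (base_nbhs bV K.+1) th01.
have [|nu [iU Onu]] := dO (interior U) _ (open_interior U).
  by exists (law (unif R) mphi); exact: nU.
have nuUO : nbhs nu (U `&` O).
  by apply: filterI; [exact: iU|apply: open_nbhs_nbhs; split].
have [chi [mchi [schi [Uchi Ochi]]]] := simple_law_dense nuUO.
have [psi [spsi psichi phipsi]] := UP _ mchi schi Uchi.
have mpsi := simple_measurable spsi.
have Opsi : O (law (unif R) mpsi).
  apply: eq_law_open oO _ Ochi => B mB.
  rewrite (lawE (unif R) mpsi mB) (lawE (unif R) mchi mB).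
  have [mp _] := spsi; have [mc _] := schi.
  by rewrite (prE (unif R) (mp B)) (prE (unif R) (mc B)) psichi.
have [W [r [nW r0 WP]]] := law_stable spsi (open_nbhs_nbhs (conj oO Opsi)).
have [n0 VW] := base_small bV nW.
have [n1 n1P] := exprV2_small r0.
exists psi, (maxn (maxn n0 n1) K.+1); split=> //; first by rewrite leq_maxr.
move=> chi' mchi' [N [mN PN] NP]; apply: WP; exists N.
  split=> //; apply: le_trans PN _; apply: le_trans n1P.
  by apply: ler_wiXn2l; rewrite ?invr_ge0 ?invf_le1 ?ler1n//; lia.
by move=> t /NP Vt; apply: VW; apply: (base_mono bV) Vt; lia.
Qed.

(** Approximating laws are realized by simple random variables on one probability
    space, coupled so as to converge in probability fast enough; the law of their
    limit stays within the tolerance of every step. *)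
Lemma borel_prob_baire (O : nat -> set (borel_prob R X)) :
  (forall n, open (O n)) -> (forall n, dense (O n)) ->
  exists mu, forall n, O n mu.
Proof.
move=> oO dO; have [V bV] := exists_group_base hX.
pose P (k : nat) (p q : (Om -> X) * nat) := simple_rv p.1 ->
  [/\ simple_rv q.1, (p.2 < q.2)%N,
    close_rv (unif R) p.1 (V p.2.+1) (2^-1 ^+ p.2.+1) q.1 &
    forall (chi : Om -> borel X) (mchi : measurable_fun setT chi),
      close_rv (unif R) q.1 (V q.2) (2^-1 ^+ q.2) chi -> O k (law (unif R) mchi)].
have step k p : exists q, P k p q.
  have [sp|] := pselect (simple_rv p.1); last by exists p.
  have [psi [L h]] := simple_step p.2 bV (oO k) (dO k) sp.
  by exists (psi, L).
pose next k p := projT1 (cid (step k p)).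
have nextP k p : P k p (next k p) := projT2 (cid (step k p)).
pose st := fix st k := if k is k'.+1 then next k' (st k') else (fun=> 0, 0%N).
have stS k : st k.+1 = next k (st k) by [].
have sst k : simple_rv (st k).1.
  elim: k => [|k IHk]; last by have [h _ _ _] := nextP k _ IHk; rewrite stS.
  split=> [B|]; last by exists [:: 0] => t; rewrite mem_head.
  by rewrite preimage_cst; case: ifP.
have [|||psi mpsi psiP] := @rv_limit R X _ Om (unif R) V (fun k => (st k).2)
    (fun k => (st k).1) hX bV.
- by move=> n; exact: simple_measurable.
- by move=> n; have [_ h _ _] := nextP n _ (sst n); rewrite stS.
- by move=> n; have [_ _ h _] := nextP n _ (sst n).
exists (law (unif R) mpsi) => n; have [_ _ _] := nextP n _ (sst n); apply.
exact: (psiP n.+1).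
Qed.

End baire.

(** * Closed Haar-null sets in locally compact groups *)

Section product_probability.
Context d1 d2 (T1 : measurableType d1) (T2 : measurableType d2) (R : realType).
Variables (P : probability T1 R) (Q : probability T2 R).

Definition product_prob : set (T1 * T2) -> \bar R := (P \x Q)%E.

HB.instance Definition _ := Measure.on product_prob.

Let product_probT : product_prob setT = 1%E.
Proof.
rewrite /product_prob -setXTT; transitivity (P setT * Q setT)%E.
  exact: product_measure1E.
by rewrite !probability_setT mule1.
Qed.

HB.instance Definition _ :=
  Measure_isProbability.Build _ _ _ product_prob product_probT.

End product_probability.

Section witnesses.
Variables (R : realType) (X : topologicalZmodType).
Hypothesis hX : polish R X.

Definition translate (x : X) (A : set X) : set X := [set x + a | a in A].

Lemma translateE x A y : translate x A y <-> A (y - x).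
Proof.
split=> [[a Aa <-]|Ayx]; first by rewrite addrAC subrr add0r.
by exists (y - x) => //; rewrite addrCA subrr addr0.
Qed.

Lemma closed_translate x A : closed A -> closed (translate x A).
Proof.
move=> cA y cy; apply/translateE/cA => U nU.
have : nbhs y [set z | U (- x + z)].
  by apply: (@nbhs_translate X (- x) y U); rewrite addrC.
by move=> /cy[z [/translateE Az Uz]]; exists (z - x); split=> //; rewrite addrC.
Qed.

Lemma closed_witness (A : set X) (mu : borel_prob R X) : closed A ->
  @witness_measures R X A mu <-> forall x, pr mu (translate x A : set (borel X)) = 0.
Proof.
move=> cA; have h x : completion mu [set x + a | a in A] = mu (translate x A).
  have := completionE (closed_borel (closed_translate (x := x) cA)) (negligible_set0 mu).
  by rewrite setU0.
split=> mu0 x; first by rewrite /pr -h (mu0 x).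
by rewrite h (prE mu) ?mu0//; apply: closed_borel; exact: closed_translate.
Qed.

Lemma closed_universally_measurable (A : set X) :
  closed A -> universally_measurable R A.
Proof.
move=> cA mu; exists A; first exact: closed_borel.
by exists set0; [exact: negligible_set0|rewrite setU0].
Qed.

(** The open neighbourhoods [H n] of x + A decrease to x + A, so one of them still
    has small mass; a continuous function between a smaller neighbourhood and
    [H n] keeps the mass of nearby translates small for nearby measures. *)
Lemma open_small_translates (A L : set X) (r : R) : closed A -> compact L ->
  open [set mu : borel_prob R X |
    forall x, L x -> pr mu (translate x A : set (borel X)) < r].
Proof.
move=> cA cL; rewrite openE.
suff h (mu : borel_prob R X) :
    (forall x, L x -> pr mu (translate x A : set (borel X)) < r) ->
    nbhs mu [set nu : borel_prob R X |
      forall x, L x -> pr nu (translate x A : set (borel X)) < r].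
  by move=> mu; exact: h.
move=> muL; have [V bV] := exists_group_base hX.
have mtr x : measurable (translate x A : set (borel X)).
  by apply: closed_borel; exact: closed_translate.
have := (compact_near_coveringP L).1 cL _ (nbhs mu)
  (fun (nu : borel_prob R X) x => pr nu (translate x A : set (borel X)) < r).
apply=> x Lx.
pose H n : set X := [set y | exists2 a, A a & interior (V n) (y - x - a)].
have oH n : open (H n).
  rewrite openE => y [a Aa]; rewrite /interior => Vy.
  have /group_nbhs0P nV := Vy.
  have : nbhs y [set z | interior (V n) (z - x - a)].
    apply/group_nbhs0P.
    have /nbhs_interior/group_nbhs0P := Vy.
    by apply: filterS => z /=; rewrite (_ : y - x - a + z = y + z - x - a)//; zmod.
  by apply: filterS => z Vz; exists a.
have capH : \bigcap_n H n = translate x A.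
  apply/seteqP; split=> y; last first.
    move=> [a Aa <-] n _; exists a => //.
    rewrite (_ : x + a - x - a = 0); last by zmod.
    exact: (base_nbhs bV).
  move=> Hy; apply/translateE/cA; apply: (base_closure bV) => n.
  have [a Aa /interior_subset Va] := Hy n I; exists a => //.
  by rewrite -opprB; exact: (base_opp bV).
have [n Hn] : exists n, pr mu (H n : set (borel X)) < r.
  have mH n : measurable (H n : set (borel X)) by exact: open_borel.
  have mu_tr : pr mu (translate x A : set (borel X)) < r by exact: muL.
  have : mu \o (H : nat -> set (borel X)) @ \oo --> (pr mu (translate x A : set (borel X)))%:E.
    rewrite -prE// -capH; apply: nonincreasing_cvg_mu => //.
    - by rewrite -ge0_fin_numE// fin_num_measure.
    - by apply: bigcap_measurable.
    - move=> i j ij; apply/subsetPset => y [a Aa Va]; exists a => //.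
      by apply: filterS Va; exact: (base_mono bV).
  move=> /fine_cvg/(cvgr_lt _)/(_ _ mu_tr)[n _ h].
  by exists n; exact: (h n (leqnn n)).
have VI m : V m.+1 `<=` interior (V m).
  move=> v Vv; apply/group_nbhs0P; apply: filterS (base_nbhs bV m.+1) => w.
  exact: (base_add bV).
pose C := closure [set y | exists2 a, A a & V n.+2 (y - x - a)].
have CH y : C y -> H n y.
  move=> /(_ _ (base_nbhsx bV y n.+2))[z [[a Aa Vz] /= Vzy]].
  exists a => //; apply: VI.
  rewrite (_ : y - x - a = (z - x - a) - (z - y)); last by zmod.
  exact: (base_sub bV).
have [|||f [fc f01 f1 f0]] := @separating_function R X hX C (~` H n).
- exact: closed_closure.
- exact: open_closedC.
- by move=> y /CH Hy; apply.
have [|g gE] := @make_bounded_continuous R X f 1 fc.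
  by move=> y; have := f01 y; rewrite ler_norml; lra.
have mid : measurable_fun setT (idfun : borel X -> borel X) by exact: measurable_id.
rewrite -gE in f01 f1 f0.
have : \int[mu]_y sval g y < r.
  apply: le_lt_trans Hn.
  by apply: (@integral_le_pr R X _ _ mu g idfun (H n)) => //; exact: open_borel.
move=> /expectation_lt ng.
exists ([set x' | V n.+2 (x' - x)], [set nu : borel_prob R X | \int[nu]_y sval g y < r]).
  by split=> //=; exact: (base_nbhsx bV).
move=> [x' nu] [/= Vx' nur]; apply: le_lt_trans nur.
apply: (@pr_le_integral R X _ _ nu g idfun) => // y /translateE Ay.
apply: f1; apply: subset_closure.
by exists (y - x') => //; rewrite (_ : y - x - (y - x') = x' - x)//; zmod.
Qed.

Section translate_density.
Variable V : set X.
Hypotheses (nV : nbhs 0 V) (cV : closed V).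

(** Moving the points of X into a neighbourhood of 0 by countably many translations
    preserves witnesses: the preimage of a translate of A is covered by countably
    many translates of A. *)
Lemma countable_translation : exists (rho : borel X -> borel X) (q : nat -> X),
  [/\ measurable_fun setT rho, forall y, V (rho y) &
      forall y, exists n, (rho y : X) = y - q n].
Proof.
have [q qd] := dense_sequence hX.
pose D n : set X := [set y | V (y - q n)].
have cD n : closed (D n).
  have := @closed_translate (q n) V cV; rewrite (_ : translate _ _ = D n)//.
  by apply/seteqP; split=> y /translateE.
have mD n : measurable (D n : set (borel X)) by exact: closed_borel.
have Dex y : exists n, D n y.
  have nN := nbhs0N nV; have [|n qn] := qd y [set z | V (y - z)].
    apply/group_nbhs0P; apply: filterS nN => z /=.
    by rewrite opprD addrA subrr add0r.
  by exists n.
have /choice[N NP] y : exists n, D n y /\ forall k, (k < n)%N -> ~ D k y.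
  have ex : exists n, `[< D n y >] by have [n Dn] := Dex y; exists n; exact/asboolP.
  case: (ex_minnP ex) => n /asboolP Dn nmin; exists n; split=> // k kn /asboolP/nmin.
  by rewrite leqNgt kn.
have mN n : measurable (N @^-1` [set n] : set (borel X)).
  rewrite (_ : _ @^-1` _ = D n `&` \bigcap_(k < n) ~` D k).
    by apply: measurableI => //; apply: bigcap_measurableType => k _; exact: measurableC.
  apply/seteqP; split=> y /=; first by move=> <-; have [? h] := NP y; split.
  move=> [Dn nD]; have [Dy h] := NP y.
  by case: (ltngtP (N y) n) => // [lt|/h//]; case: (nD _ lt).
exists (fun y : X => y - q (N y)), q; split.
- apply: measurable_rv => C cC.
  rewrite (_ : _ @^-1` _ = \bigcup_n (N @^-1` [set n] `&` translate (q n) C)).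
    apply: bigcup_measurable => n _; apply: measurableI => //.
    by apply: closed_borel; exact: closed_translate.
  apply/seteqP; split=> y /= => [Cy|[n _ [/= <- /translateE//]]].
  by exists (N y) => //; split=> //; exact/translateE.
- by move=> y; have [] := NP y.
- by move=> y; exists (N y).
Qed.

End translate_density.

(** The convolution of a simple law with a witness moved close to 0 is again a
    witness; it is realized on the product of the two probability spaces. *)
Lemma dense_witness (A : set X) : closed A ->
  (exists mu : borel_prob R X, @witness_measures R X A mu) ->
  dense (@witness_measures R X A).
Proof.
move=> cA [mu0 /(closed_witness _ cA) mu0A] U [nu Unu] oU.
have [chi [mchi [schi Uchi]]] := simple_law_dense (open_nbhs_nbhs (conj oU Unu)).
have [mc [s chis]] := schi.
pose P := product_prob (unif R) mu0.
pose psi (p : measurableTypeR R * borel X) : X := chi p.1.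
have spsi : simple_rv psi.
  split=> [B|]; last by exists s => p; exact: chis.
  rewrite (_ : psi @^-1` B = (chi @^-1` B) `*` setT).
    by apply: measurableX => //; exact: mc.
  by apply/seteqP; split=> p //= [].
have mpsi := simple_measurable spsi.
have Upsi : U (law P mpsi).
  apply: eq_law_open oU _ Uchi => B mB.
  rewrite (lawE (unif R) mchi mB) (lawE P mpsi mB).
  rewrite (_ : psi @^-1` B = (chi @^-1` B) `*` setT); last first.
    by apply/seteqP; split=> p //= [].
  transitivity (unif R (chi @^-1` B) * mu0 setT)%E.
    by rewrite probability_setT mule1.
  by apply/esym/product_measure1E => //; exact: mc.
have [W [r [nW r0 WP]]] := law_stable spsi (open_nbhs_nbhs (conj oU Upsi)).
have [V [nV cV _ VW]] := nbhs0_closed nW.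
have [rho [q [mrho rhoV rhoq]]] := countable_translation nV cV.
pose chi' (p : measurableTypeR R * borel X) : borel X := chi p.1 + (rho p.2 : X).
have mchi' : measurable_fun setT chi'.
  apply: measurable_rv => C cC.
  rewrite (_ : _ @^-1` _ = \bigcup_(a in [set` s])
      ((chi @^-1` [set a]) `*` (rho @^-1` translate (- a) C))).
    apply: fin_bigcup_measurable => // a _; apply: measurableX; first exact: mc.
    rewrite -[X in measurable X]setTI; apply: mrho => //.
    by apply: closed_borel; exact: closed_translate.
  apply/seteqP; split=> -[t y] /=.
    move=> Cty; exists (chi t); first exact: chis.
    by split=> //=; apply/translateE; rewrite opprK addrC.
  by move=> [a _ [/= ta /translateE]]; rewrite opprK addrC -ta.
exists (law P mchi'); split.
  apply: WP; exists set0; first by rewrite pr0 ltW.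
  move=> p _; rewrite /chi' /psi addrAC subrr add0r -[rho _]addr0.
  by apply: VW; [exact: rhoV|exact: nbhs_singleton].
apply/closed_witness => // x.
have mtr y : measurable (translate y A : set (borel X)).
  by apply: closed_borel; exact: closed_translate.
rewrite /pr lawE// /P /product_prob /=.
rewrite [X in fine X](_ : _ = 0%E)//.
rewrite /product_measure1; apply: integral0_eq => t _ /=.
have mS : measurable (chi' @^-1` translate x A).
  by rewrite -[X in measurable X]setTI; apply: mchi'.
apply/eqP; rewrite eq_le measure_ge0 andbT.
pose F n : set (borel X) := translate (x - chi t + q n) A.
have F0 n : mu0 (F n) = 0%E by rewrite (prE mu0 (mtr _)) mu0A.
apply: (@le_trans _ _ (\sum_(n <oo) mu0 (F n))%E); last first.
  by rewrite eseries0// => n _ _; exact: F0.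
apply: measure_sigma_subadditive.
- by move=> n; exact: mtr.
- exact: measurable_xsection.
- move=> y; rewrite /xsection /= inE => /translateE Ay.
  have [n rn] := rhoq y; exists n => //; apply/translateE.
  move: Ay; rewrite /chi' /= rn.
  by rewrite (_ : chi t + (y - q n) - x = y - (x - chi t + q n))//; zmod.
Qed.

(** As the group is sigma-compact, being a witness is the conjunction of countably
    many open conditions, one for each compact piece and each bound of the form
    [k.+1%:R^-1]. *)
Lemma locally_compact_comeager (A : set X) : locally_compact [set: X] ->
  closed A -> haar_null R A -> comeager (@witness_measures R X A).
Proof.
move=> lc cA [_ exmu].
have [L cL LX] := locally_compact_sigma hX lc.
pose O (p : nat * nat) : set (borel_prob R X) := [set mu |
  forall x, L p.1 x -> pr mu (translate x A : set (borel X)) < p.2.+1%:R^-1].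
have WO : @witness_measures R X A = \bigcap_p O p.
  apply/seteqP; split=> mu.
    by move=> /(closed_witness _ cA) muA p _ x _; rewrite muA invr_gt0.
  move=> muO; apply/closed_witness => // x; apply/eqP.
  have [n Lx] := LX x; rewrite eq_le pr_ge0 andbT leNgt; apply/negP => mu0.
  have := muO (n, Num.trunc (pr mu (translate x A : set (borel X)))^-1) I x Lx.
  rewrite /= ltNge => /negP; apply; rewrite -[leRHS]invrK.
  by rewrite lef_pV2 ?posrE ?invr_gt0//; exact/ltW/truncnS_gt.
exists (fun n => if unpickle n is Some p then ~` O p else set0).
  move=> n; rewrite /nowhere_dense; case: (unpickle n) => [p|]; last first.
    by rewrite closure0 interior0.
  have oO : open (O p) by exact: open_small_translates.
  rewrite -(closure_id (~` O p)).1; last exact: open_closedC.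
  apply/seteqP; split=> // mu imu.
  have [|nu [inu wnu]] := dense_witness cA exmu _ (open_interior (~` O p)).
    by exists mu.
  by have := interior_subset inu; case; move: wnu; rewrite WO => /(_ p I).
rewrite WO setC_bigcap; apply/seteqP; split=> mu [].
  by move=> p _ Op; exists (pickle p) => //; rewrite pickleK.
by move=> n _; case: (unpickle n) => // p Op; exists p.
Qed.

End witnesses.

(** * A measure with small mass on small sets *)

Section spread.
Variables (R : realType) (X : topologicalZmodType) (V : nat -> set X).
Hypotheses (hX : polish R X) (bV : group_base V).
Local Notation Om := (measurableTypeR R).

(** The n-th iterate of the doubling map: the tail of the binary expansion of t
    after n digits. *)
Fixpoint doubling (n : nat) (t : Om) : R :=
  if n is n'.+1 then
    2 * doubling n' t - (2^-1 <= doubling n' t)%R%:R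
  else t.

Definition digit (n : nat) (t : Om) : bool := 2^-1 <= doubling n t.

Lemma doubling_ge0_le1 n t : 0 <= t <= 1 -> 0 <= doubling n t <= 1.
Proof.
move=> t01; elim: n => //= n IHn; case: (lerP 2^-1 (doubling n t)) => /= h; lra.
Qed.

Lemma doubling_sub n t t' : (forall i, (i < n)%N -> digit i t = digit i t') ->
  doubling n t - doubling n t' = 2 ^+ n * (t - t').
Proof.
elim: n => [|n IHn] h /=; first by rewrite expr0 mul1r.
have := h n (ltnSn n); rewrite /digit => ->.
rewrite exprS -mulrA -IHn; first by ring.
by move=> i ni; apply: h; exact: ltnW.
Qed.

Lemma digits_close n t t' : 0 <= t <= 1 -> 0 <= t' <= 1 ->
  (forall i, (i < n)%N -> digit i t = digit i t') -> `|t - t'| <= 2^-1 ^+ n.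
Proof.
move=> t01 t'01 /doubling_sub h.
have d01 := doubling_ge0_le1 n t01; have d'01 := doubling_ge0_le1 n t'01.
rewrite exprVn -[leRHS]mul1r ler_pdivlMr ?exprn_gt0//.
rewrite -[X in _ * X]gtr0_norm ?exprn_gt0// -normrM mulrC -h ler_norml; lra.
Qed.

Lemma measurable_doubling n : measurable_fun setT (doubling n).
Proof.
elim: n => [|n IHn]; first exact: measurable_id.
apply: measurable_funB; first by apply: measurable_funM => //; exact: measurable_cst.
rewrite (_ : (fun t => _) = \1_[set t | 2^-1 <= doubling n t]); last first.
  by apply/funext => t; rewrite indicE mem_setE.
apply: measurable_indic.
rewrite (_ : [set t | _] = doubling n @^-1` `[2^-1, +oo[).
  by rewrite -[X in measurable X]setTI; apply: IHn => //; exact: measurable_itv.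
by apply/seteqP; split=> t; rewrite /= in_itv/= andbT.
Qed.

Lemma measurable_digit n : measurable [set t | digit n t].
Proof.
rewrite (_ : [set t | _] = doubling n @^-1` `[2^-1, +oo[).
  by rewrite -[X in measurable X]setTI; apply: measurable_doubling => //; exact: measurable_itv.
by apply/seteqP; split=> t; rewrite /= in_itv/= andbT.
Qed.

(** The function is a series [sum_i digit_i h_i] with rapidly decreasing terms.
    Partial sums take finitely many values, which makes the range totally bounded;
    the first digit in which two points differ can be read off from the difference
    of the values. *)
Lemma spread_rv : (forall n, ~ (V n `<=` V n.+1)) ->
  exists f : Om -> borel X, [/\ measurable_fun setT f,
    forall n, exists D : seq X, forall t t', exists2 d, d \in D &
      V n ((f t : X) - f t' - d) &
    forall n t t', 0 <= t <= 1 -> 0 <= t' <= 1 -> V (4 * n) ((f t : X) - f t') ->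
      `|t - t'| <= 2^-1 ^+ n].
Proof.
move=> nV.
(* The spacing 4 leaves room for the three error terms below: sums of three
   elements of V (4 * i + 4) stay in V (4 * i + 2), which h i avoids. *)
have /choice[h hP] i : exists h, V (4 * i).+1 h /\ ~ V (4 * i).+2 h.
  have /existsNP[x /not_implyP[Vx nVx]] := nV (4 * i).+1.
  by exists x.
pose term t i : X := if digit i t then h i else 0.
pose S n t : borel X := \sum_(i < n) term t i.
have term_V t i : V (4 * i).+1 (term t i).
  by rewrite /term; case: ifP => _; [have [] := hP i|exact: base0].
have tail t n j : V (4 * n) ((S (n + j)%N t : X) - S n t).
  rewrite (_ : _ - _ = \sum_(i < j) term t (n + i)%N).
    apply: (base_sum bV (x := fun i => term t (n + i)%N)) => i.
    by apply: (base_mono bV) (term_V t (n + i)%N); lia.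
  by rewrite /S big_split_ord /= addrAC subrr add0r.
have /choice[f fP] t : exists l : X, (fun n => S n t : X) @ \oo --> l.
  apply: (polish_group_complete hX bV) => k; exists k.+1 => m n km kn.
  rewrite (_ : _ - _ = ((S m t : X) - S k.+1 t) - ((S n t : X) - S k.+1 t)); last by zmod.
  apply: (base_sub bV); apply: (base_mono bV (n := (4 * k.+1)%N)); try lia.
    by rewrite -(subnKC km).
  by rewrite -(subnKC kn).
have fS t n : V (4 * n) (f t - S n t).
  have cl := base_translate_closed bV (a := S n t : X) (n := (4 * n)%N).
  apply: (@closed_cvg _ X \oo _ (fun n => S n t : X)
    [set z | V (4 * n) (z - (S n t : X))] cl _ (f t) (fP t)).
  by exists n => // m /= nm; rewrite -(subnKC nm).
have mS n : measurable_fun setT (S n).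
  elim: n => [|n IHn].
    by rewrite (_ : S 0%N = fun=> 0 : X)//; apply/funext => t; rewrite /S big_ord0.
  apply: measurable_rv => C cC.
  rewrite (_ : _ @^-1` _ =
      ([set t | digit n t] `&` S n @^-1` translate (- h n) C) `|`
      (~` [set t | digit n t] `&` S n @^-1` C)).
    have mC (B : set X) : closed B -> measurable (S n @^-1` B).
      move=> cB; rewrite -[X in measurable X]setTI; apply: IHn => //.
      exact: closed_borel.
    apply: measurableU; apply: measurableI; [exact: measurable_digit| | |exact: mC].
      by apply: mC; exact: closed_translate.
    by apply: measurableC; exact: measurable_digit.
  have SS t : S n.+1 t = (S n t : X) + term t n by rewrite /S big_ord_recr.
  apply/seteqP; split=> t /=; rewrite SS /term.
    case: ifP => dn; rewrite ?addr0 => Ct; [left|right]; split=> //.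
    by apply/translateE; rewrite opprK.
  by move=> [[-> /translateE]|[/negP/negbTE -> ?]]; rewrite ?opprK ?addr0.
exists f; split.
- exact: (measurable_rv_limit hX mS fP).
- move=> n.
  pose PS := fix PS n := if n is n'.+1 then PS n' ++ [seq x + h n' | x <- PS n'] else [:: 0 : X].
  have SPS k t : (S k t : X) \in PS k.
    elim: k => [|k IHk]; first by rewrite /S big_ord0 mem_head.
    rewrite /S big_ord_recr /= mem_cat -/(S k t) /term; case: ifP => _.
      by rewrite (map_f (fun x => x + h k) IHk) orbT.
    by rewrite addr0 IHk.
  exists [seq a - b | a <- PS n.+1, b <- PS n.+1] => t t'.
  exists ((S n.+1 t : X) - S n.+1 t').
    by apply/allpairsP; exists (S n.+1 t : X, S n.+1 t' : X); split; try exact: SPS.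
  rewrite (_ : _ - _ = (f t - S n.+1 t) - (f t' - S n.+1 t')); last by zmod.
  by apply: (base_sub bV); apply: (base_mono bV) (fS _ n.+1); lia.
- move=> n t t' t01 t'01 Vff; apply: digits_close => //.
  suff agree k : (k <= n)%N -> forall i, (i < k)%N -> digit i t = digit i t'.
    exact: agree.
  elim: k => // k IHk kn i; rewrite ltnS leq_eqVlt => /predU1P[->|ik]; last first.
    by apply: IHk => //; exact: ltnW.
  have SS : (S k t : X) = S k t'.
    by apply: eq_bigr => j _; rewrite /term (IHk (ltnW kn) j (ltn_ord j)).
  have Vterm : V (4 * k).+2 (term t k - term t' k).
    rewrite (_ : _ - _ = (f t - f t') - (f t - S k.+1 t) + (f t' - S k.+1 t')).
      apply: (base_add bV); last by apply: (base_mono bV) (fS t' k.+1); lia.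
      apply: (base_sub bV); last by apply: (base_mono bV) (fS t k.+1); lia.
      by apply: (base_mono bV) Vff; lia.
    have SkE u : (S k.+1 u : X) = (S k u : X) + term u k by rewrite /S big_ord_recr.
    by rewrite !SkE SS; zmod.
  have [_ nVh] := hP k; move: Vterm; rewrite /term.
  case: (digit k t); case: (digit k t') => //.
    by rewrite subr0 => /nVh.
  by rewrite sub0r => /(base_opp bV); rewrite opprK => /nVh.
Qed.

Lemma measurable_near d (T : measurableType d) (f : T -> borel X) n (c : X) :
  measurable_fun setT f -> measurable [set t | V n ((f t : X) - c)].
Proof.
move=> mf; rewrite (_ : [set t | _] = f @^-1` translate c (V n)).
  rewrite -[X in measurable X]setTI; apply: mf => //; apply: closed_borel.
  by apply: closed_translate; exact: base_closed.
by apply/seteqP; split=> t /= /translateE.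
Qed.

Lemma spread_mass (f : Om -> borel X) n (c : X) : measurable_fun setT f ->
  (forall t t', 0 <= t <= 1 -> 0 <= t' <= 1 -> V (4 * n) ((f t : X) - f t') ->
    `|t - t'| <= 2^-1 ^+ n) ->
  pr (unif R) [set t | V (4 * n).+1 ((f t : X) - c)] <= 2 * 2^-1 ^+ n.
Proof.
move=> mf fn; have r0 : 0 <= (2^-1 : R) ^+ n by rewrite exprn_ge0 ?invr_ge0.
have mS := measurable_near (4 * n).+1 c mf.
have [[t0 [Vt0 t01]]|h] := pselect (exists t, V (4 * n).+1 ((f t : X) - c) /\ 0 <= t <= 1).
  apply: le_trans (unif_interval (a := t0 - 2^-1 ^+ n) (b := t0 + 2^-1 ^+ n) mS _ _) _.
  - lra.
  - move=> t Vt t01'; suff : `|t - t0| <= 2^-1 ^+ n by rewrite ler_norml; lra.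
    apply: fn => //; rewrite (_ : _ - _ = ((f t : X) - c) - ((f t0 : X) - c)); last by zmod.
    exact: (base_sub bV).
  - lra.
apply: le_trans (unif_interval (a := 0) (b := 0) mS _ _) _ => //; last by lra.
by move=> t Vt t01; case: h; exists t.
Qed.

End spread.

(** * The coded set *)

Lemma closed_seq_union (X : topologicalType) (I : eqType) (s : seq I)
    (B : I -> set X) : (forall a, closed (B a)) ->
  closed [set y | exists2 a, a \in s & B a y].
Proof.
move=> cB; elim: s => [|b s IHs].
  rewrite (_ : [set y | _] = set0); first exact: closed0.
  by apply/seteqP; split=> // y [].
rewrite (_ : [set y | _] = B b `|` [set y | exists2 a, a \in s & B a y]).
  exact: closedU.
apply/seteqP; split=> y.
  by move=> [a]; rewrite inE => /orP[/eqP ->|sa] ay; [left|right; exists a].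
by move=> [yb|[a sa ay]]; [exists b; rewrite ?mem_head|exists a; rewrite // inE sa orbT].
Qed.

Lemma pr_seq_union (R : realType) d (T : measurableType d) (P : probability T R)
    (I : eqType) (s : seq I) (B : I -> set T) (r : R) :
  (forall a, measurable (B a)) -> (forall a, pr P (B a) <= r) ->
  pr P [set t | exists2 a, a \in s & B a t] <= (size s)%:R * r.
Proof.
move=> mB Br.
suff [] : measurable [set t | exists2 a, a \in s & B a t] /\
  pr P [set t | exists2 a, a \in s & B a t] <= (size s)%:R * r by [].
elim: s => [|b s [mU IHs]].
  rewrite (_ : [set t | _] = set0); last by apply/seteqP; split=> // t [].
  by rewrite pr0 mul0r; split.
have -> : [set t | exists2 a, a \in b :: s & B a t] =
    B b `|` [set t | exists2 a, a \in s & B a t].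
  apply/seteqP; split=> y.
    by move=> [a]; rewrite inE => /orP[/eqP ->|sa] ay; [left|right; exists a].
  by move=> [yb|[a sa ay]]; [exists b; rewrite ?mem_head|exists a; rewrite // inE sa orbT].
have mUb := measurableU _ _ (mB b) mU; split=> //.
rewrite (pr_split P mUb (mB b)) /= -natr1 mulrDl mul1r [leRHS]addrC; apply: lerD.
  apply: le_trans (Br b); apply: pr_le => [||t []//]; last exact: mB.
  by apply: measurableI => //; exact: mB.
apply: le_trans IHs; apply: pr_le => //.
  by apply: measurableI => //; exact: measurableC.
by move=> t [[]].
Qed.

Section coded_set.
Variables (R : realType) (X : topologicalZmodType) (V : nat -> set X).
Hypotheses (hX : polish R X) (bV : group_base V).
Variables (F : nat -> seq X) (D : nat -> seq X).
Variables (m : nat -> nat -> nat) (g : nat -> nat -> X).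

Definition near_finite k (x : X) := exists2 d, d \in D k & V (k + 5) (x - d).

Hypothesis m_ge : forall k j, (k + 5 <= m k j)%N.
Hypothesis D_0 : forall k, 0 \in D k.
Hypothesis g_small : forall k j, V k.+2 (g k j).
(* Comparing two points involves three errors of level k + 5, whose sum is of
   level k + 3. *)
Hypothesis g_apart : forall k i j a a' d, (i < j)%N -> a \in F i -> a' \in F j ->
  d \in D k -> ~ V k.+3 (g k j - (g k i + a - a' + d)).

(** A code z chooses the finite sets [F (z l)]; the scale of each step depends
    on the choices made before, so that the next shifts are small with respect
    to the current cell. *)
Fixpoint state (z : nat -> nat) l : nat * X :=
  if l is l'.+1 then
    let p := state z l' in (m p.1 (z l'), p.2 + g p.1 (z l'))
  else (0%N, 0).

Definition level z l := (state z l).1.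
Definition shift z l := (state z l).2.

Definition cell z l : set X :=
  [set y | exists2 a, a \in F (z l) & V (level z l.+1) (y - (shift z l.+1 + a))].

Definition coded : set X := [set y | exists z, forall l, cell z l y].

Lemma state_ext z z' l : (forall i, (i < l)%N -> z i = z' i) ->
  state z l = state z' l.
Proof.
elim: l => //= l IHl h; rewrite IHl ?h// => i il.
by apply: h; exact: ltnW.
Qed.

Lemma level_lt z l : (level z l + 5 <= level z l.+1)%N.
Proof. exact: m_ge. Qed.

Lemma level_add z l i : (level z l + i <= level z (l + i))%N.
Proof.
elim: i => [|i IHi]; first by rewrite !addn0.
by rewrite !addnS; have := level_lt z (l + i); lia.
Qed.

Lemma level_mono z i l : (i <= l)%N -> (level z i <= level z l)%N.
Proof. by move=> /subnKC <-; have := level_add z i (l - i); lia. Qed.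

Lemma level_ge z l : (l <= level z l)%N.
Proof. by have := level_add z 0 l; rewrite add0n; lia. Qed.

(** Shifts with different labels are apart, even modulo the finite sets. *)
Lemma cell_lt z z' l y y' : state z l = state z' l -> cell z l y ->
  cell z' l y' -> near_finite (level z l) (y' - y) -> ~ (z l < z' l)%N.
Proof.
move=> zz' [a Fa Va] [a' Fa' Va'] [d Dd Vd] lt.
set k := level z l in Vd Dd.
apply: (g_apart lt Fa Fa' Dd).
have kE : level z' l = k by rewrite /level -zz'.
have Vk : V (k + 5) (y - (shift z l.+1 + a)).
  by apply: (base_mono bV) Va; exact: level_lt.
have Vk' : V (k + 5) (y' - (shift z' l.+1 + a')).
  by apply: (base_mono bV) Va'; rewrite -kE; exact: level_lt.
rewrite (_ : _ - _ = (y' - y - d) - (y' - (shift z' l.+1 + a'))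
                     + (y - (shift z l.+1 + a))); last first.
  rewrite /shift /= -zz' -/(level z l) -/k; zmod.
rewrite (_ : (k + 5)%N = k.+4.+1) in Vk Vk' Vd; last by lia.
apply: (base_add bV); first exact: (base_sub bV).
by apply: (base_mono bV) Vk.
Qed.

(** Consider the first place where the codes differ: up to there the levels and
    shifts are the same, so that the two cells belong to the same family. *)
Lemma codes_agree z z' y y' l : (forall i, cell z i y) ->
  (forall i, cell z' i y') ->
  (forall i, (i < l)%N -> near_finite (level z i) (y - y') /\
                          near_finite (level z i) (y' - y)) ->
  forall i, (i < l)%N -> z i = z' i.
Proof.
move=> zy z'y'; elim: l => // l IHl near_yy' i.
rewrite ltnS leq_eqVlt => /predU1P[->|]; last first.
  by apply: IHl => j jl; apply: near_yy'; exact: ltnW.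
have zz' : state z l = state z' l.
  by apply: state_ext; apply: IHl => j jl; apply: near_yy'; exact: ltnW.
have [yy' y'y] := near_yy' l (ltnSn l).
case: (ltngtP (z l) (z' l)) => // lt; exfalso.
  exact: (cell_lt zz' (zy l) (z'y' l) y'y).
by apply: (cell_lt (esym zz') (z'y' l) (zy l)) lt; rewrite /level -zz'.
Qed.

Lemma closed_cell z l : closed (cell z l).
Proof.
apply: (closed_seq_union (B := fun a => [set y | V (level z l.+1) (y - (shift z l.+1 + a))])).
by move=> a; exact: base_translate_closed.
Qed.

(** The codes of a convergent sequence of coded points stabilize, and the limit
    follows the resulting code since cells are closed. *)
Lemma closed_coded : closed coded.
Proof.
move=> y cy.
have /choice[u uP] n : exists u, coded u /\ V n (u - y).
  by have [u [cu Vu]] := cy _ (base_nbhsx bV y n); exists u.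
have /choice[z zP] n : exists z, forall l, cell z l (u n) by have [] := uP n.
have uV n i : (n < i)%N -> V n (u i - y) by move=> /ltnW ni; apply: (base_mono bV ni); have [] := uP i.
have stab l : exists N, forall n i, (N <= n)%N -> (i < l)%N -> z n i = z N i.
  elim: l => [|l [N NP]]; first by exists 0%N.
  pose K := level (z N) l; exists (maxn N K.+4.+4) => n i Nn il.
  set M := maxn N _ in Nn *.
  apply/esym; apply: (codes_agree (zP M) (zP n) _ il) => j jl.
  have jK : (level (z M) j <= K)%N.
    apply: leq_trans (level_mono (z M) (_ : j <= l)%N) _; first by rewrite -ltnS.
    rewrite /K /level (@state_ext (z M) (z N))// => i' i'l.
    by apply: NP => //; rewrite /M leq_maxl.
  have VM : V (K + 5) (u M - u n).
    rewrite (_ : _ - _ = (u M - y) - (u n - y)); last by zmod.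
    by apply: (base_sub bV); apply: uV; rewrite /M in Nn *; lia.
  have VK : V (level (z M) j + 5) (u M - u n).
    by apply: (base_mono bV) VM; rewrite leq_add2r.
  split; exists 0; rewrite ?subr0//.
  by rewrite -opprB; exact: (base_opp bV).
have [N NP] := choice stab.
pose w i := z (N i.+1) i.
have wP l : exists M, forall n i, (M <= n)%N -> (i < l)%N -> z n i = w i.
  elim: l => [|l [M MP]]; first by exists 0%N.
  exists (maxn M (N l.+1)) => n i; rewrite geq_max ltnS => /andP[Mn Nn].
  rewrite leq_eqVlt => /predU1P[->|]; last exact: MP.
  exact: NP.
exists w => l; apply: closed_cell => U /(base_nbhs_sub bV)[n0 VU].
have [M MP] := wP l.+1; pose n := maxn M n0.+1.
exists (u n); split; last first.
  by apply: VU; apply: uV; rewrite /n leq_maxr.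
have [a Fa Va] := zP n l.
have zw i : (i < l.+1)%N -> z n i = w i by apply: MP; rewrite /n leq_maxl.
exists a; first by rewrite -zw.
by rewrite /level /shift -(state_ext zw).
Qed.

Section spread_witness.
Local Notation Om := (measurableTypeR R).
Variable f : Om -> borel X.
Hypothesis mf : measurable_fun setT f.
Hypothesis f_near : forall k t t', near_finite k ((f t : X) - f t').
Hypothesis f_mass : forall k j, exists r : R,
  (forall c : X, pr (unif R) [set t | V (m k j) ((f t : X) - c)] <= r) /\
  (size (F j))%:R * r <= 2^-1 ^+ k.

(** All points of the range of f that belong to a fixed translate of the coded
    set have the same code, hence lie in few small sets at every scale. *)
Lemma spread_witness : @witness_measures R X coded (law (unif R) mf).
Proof.
apply/closed_witness; first exact: closed_coded.
move=> x; apply/eqP; rewrite eq_le pr_ge0 andbT.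
have mtr : measurable (translate x coded : set (borel X)).
  by apply: closed_borel; apply: closed_translate; exact: closed_coded.
rewrite /pr lawE// -/(pr (unif R) _).
have mS : measurable (f @^-1` translate x coded).
  by rewrite -[X in measurable X]setTI; exact: mf.
have [[t0 /translateE[z zP]]|none] := pselect (exists t, translate x coded (f t)); last first.
  rewrite (_ : _ @^-1` _ = set0) ?pr0//.
  by apply/seteqP; split=> // t tA; case: none; exists t.
have small l : pr (unif R) (f @^-1` translate x coded) <= 2^-1 ^+ l.
  have [r [r_ub r_size]] := f_mass (level z l) (z l).
  apply: (@le_trans _ _ (2^-1 ^+ level z l)); last first.
    by apply: ler_wiXn2l; rewrite ?invr_ge0 ?invf_le1 ?ler1n// level_ge.
  apply: le_trans r_size.
  pose B a := [set t | V (level z l.+1) ((f t : X) - (x + (shift z l.+1 + a)))].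
  have mB a : measurable (B a) by exact: measurable_near.
  apply: le_trans (pr_seq_union (F (z l)) mB (fun a => r_ub _)).
  apply: pr_le => //.
    have := fin_bigcup_measurable (F := B) (D := [set` F (z l)]).
    rewrite (_ : \bigcup_(a in _) B a = [set t | exists2 a, a \in F (z l) & B a t])//.
    by apply.
  move=> t /= /translateE[z' z'P].
  have zz' i : z i = z' i.
    apply: (codes_agree zP z'P (l := i.+1)) => // j _.
    have -> : (f t0 : X) - x - ((f t : X) - x) = (f t0 : X) - f t by zmod.
    have -> : (f t : X) - x - ((f t0 : X) - x) = (f t : X) - f t0 by zmod.
    by split; exact: f_near.
  have [a Fa Va] := z'P l; exists a; first by rewrite zz'.
  rewrite /B /= (_ : _ - _ = (f t : X) - x - (shift z l.+1 + a)); last by zmod.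
  by rewrite /level /shift (@state_ext z z').
rewrite leNgt; apply/negP => p0.
have [|l lP] := @exprV2_small R (pr (unif R) (f @^-1` translate x coded) / 2).
  by rewrite divr_gt0.
by have := le_trans (small l) lP; lra.
Qed.

End spread_witness.

(** The shifts of the code built from J converge, because their increments lie in
    rapidly shrinking neighbourhoods of 0; the limit moves every point that is near all
    the chosen finite sets into the coded set, and these points have mass at least
    one half. *)
Lemma concentrated_not_witness (mu : borel_prob R X) (J : nat -> nat) :
  (forall k, 1 - 2^-1 ^+ k.+2 < pr mu [set y : borel X |
    exists2 a, a \in F (J k) & V (m k (J k)).+1 ((y : X) - a)]) ->
  ~ @witness_measures R X coded mu.
Proof.
move=> muJ /closed_witness mu0; have {}mu0 := mu0 closed_coded.
pose st := fix st l : nat * X := if l is l'.+1 then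
  let p := st l' in (m p.1 (J p.1), p.2 + g p.1 (J p.1)) else (0%N, 0).
pose z l := J (st l).1.
have stE l : state z l = st l by elim: l => //= l ->.
have zE l : z l = J (level z l) by rewrite /z -stE.
have incr l i : V (level z l).+1 (shift z (l + i)%N - shift z l).
  pose x j := g (level z (l + j)) (z (l + j)%N).
  rewrite (_ : _ - _ = \sum_(j < i) x j).
    apply: (base_sum bV) => j; apply: (base_mono bV) (g_small _ _).
    by rewrite addSn !ltnS; exact: level_add.
  elim: i => [|i IHi]; first by rewrite addn0 subrr big_ord0.
  by rewrite big_ord_recr /= -IHi addnS /shift /= -/(level _ _) /x; zmod.
have [b bP] : exists b : X, shift z @ \oo --> b.
  apply: (polish_group_complete hX bV) => k; exists k => i j ki kj.
  rewrite (_ : _ - _ = (shift z i - shift z k) - (shift z j - shift z k)); last by zmod.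
  apply: (base_sub bV).
    by rewrite -(subnKC ki); apply: (base_mono bV) (incr _ _); rewrite ltnS level_ge.
  by rewrite -(subnKC kj); apply: (base_mono bV) (incr _ _); rewrite ltnS level_ge.
have bV' l : V (level z l).+1 (b - shift z l).
  have cl := base_translate_closed bV (a := shift z l) (n := (level z l).+1).
  apply: (@closed_cvg _ X \oo _ (shift z)
    [set y | V (level z l).+1 (y - shift z l)] cl _ b bP).
  by exists l => // i /= li; rewrite -(subnKC li).
pose E l : set (borel X) := [set y : borel X | exists2 a, a \in F (z l) &
  V (level z l.+1).+1 ((y : X) - a)].
have mE l : measurable (E l).
  apply: closed_borel; apply: (closed_seq_union
    (B := fun a => [set y : X | V (level z l.+1).+1 (y - a)])).
  by move=> a; exact: base_translate_closed.
have EA : \bigcap_l E l `<=` translate (- b) coded.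
  move=> y Ey; apply/translateE; rewrite opprK; exists z => l.
  have [a Fa Va] := Ey l I; exists a => //.
  rewrite (_ : _ - _ = (y - a) + (b - shift z l.+1)); last by zmod.
  exact: (base_add bV).
pose TA : set (borel X) := translate (- b) coded.
have mA : measurable TA.
  by apply: closed_borel; apply: closed_translate; exact: closed_coded.
have : (mu (~` TA) <= (2^-1)%:E)%E.
  apply: (@le_trans _ _ (\sum_(l <oo) mu (~` E l))%E).
    apply: measure_sigma_subadditive => [l||]; [exact: measurableC|exact: measurableC|].
    by rewrite -setC_bigcap; exact: subsetC.
  apply: (@le_trans _ _ (\sum_(l <oo) (2^-1 / (2 ^ l.+1)%:R)%:E)%E).
    apply: lee_nneseries => // l _.
    have mCE : measurable (~` E l) by exact: measurableC.
    apply: (@le_trans _ _ (pr mu (~` E l))%:E); first by rewrite -prE.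
    have : 1 - 2^-1 ^+ (level z l).+2 < pr mu (E l).
      by have := muJ (level z l); rewrite -zE.
    have : (2^-1 : R) ^+ (level z l).+2 <= 2^-1 ^+ l.+2.
      by apply: ler_wiXn2l; rewrite ?invr_ge0 ?invf_le1 ?ler1n// !ltnS level_ge.
    rewrite lee_fin prC// natrX -exprVn -exprS; lra.
  by apply: epsilon_trick0; rewrite invr_ge0.
rewrite (prE mu (measurableC mA)) prC// mu0 lee_fin; lra.
Qed.

End coded_set.

(** * Genericity of concentration, and the equivalence *)

Lemma history_choice (T : Type) (Q : seq T -> T -> Prop) :
  (forall s, exists x, Q s x) -> exists g : nat -> T, forall n, Q (mkseq g n) (g n).
Proof.
move=> /choice[c cQ].
pose hist := fix hist n := if n is n'.+1 then rcons (hist n') (c (hist n')) else [::].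
exists (fun n => c (hist n)) => n.
suff -> : mkseq (fun n => c (hist n)) n = hist n by [].
by elim: n => // n IHn; rewrite /= -[in RHS]IHn mkseqS IHn.
Qed.

Section concentration.
Variables (R : realType) (X : topologicalZmodType) (V : nat -> set X).
Hypotheses (hX : polish R X) (bV : group_base V).
Variables (F : nat -> seq X) (n : nat -> nat) (e : R).
Hypothesis e0 : 0 < e.

(** Concentration near one of the sets [F j], expressed by a test function so as
    to be an open condition. *)
Definition concentrated : set (borel_prob R X) := [set mu : borel_prob R X |
  exists j (h : bounded_continuous R X), [/\ forall x, 0 <= sval h x <= 1,
    forall x, ~ (exists2 a, a \in F j & V (n j) (x - a)) -> sval h x = 0 &
    1 - e < \int[mu]_x sval h x]].

Lemma open_concentrated : open concentrated.
Proof.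
rewrite openE.
suff h (mu : borel_prob R X) : concentrated mu -> nbhs mu concentrated.
  by move=> mu; exact: h.
move=> [j [h [h01 h0 /expectation_gt]]].
by apply: filterS => nu lt; exists j, h.
Qed.

Lemma concentratedP (mu : borel_prob R X) : concentrated mu -> exists j,
  1 - e < pr mu [set y : borel X | exists2 a, a \in F j & V (n j) ((y : X) - a)].
Proof.
move=> [j [h [h01 h0 lt]]]; exists j; apply: lt_le_trans lt _.
have mid : measurable_fun setT (idfun : borel X -> borel X) by exact: measurable_id.
apply: (@integral_le_pr R X _ _ mu h idfun _ mid) => //.
apply: closed_borel; apply: (closed_seq_union
  (B := fun a => [set y : X | V (n j) (y - a)])).
by move=> a; exact: base_translate_closed.
Qed.

(** A simple law, with its values moved into the dense sequence q, is carried by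
    one of the sets [F j]. *)
Lemma dense_concentrated (q : nat -> X) :
  (forall (x : X) U, nbhs x U -> exists i, U (q i)) ->
  (forall l : seq nat, exists j, F j = map q l) -> dense concentrated.
Proof.
move=> qd Fq U [nu Unu] oU.
have [chi [mchi [schi Uchi]]] := simple_law_dense (open_nbhs_nbhs (conj oU Unu)).
have [W [r [nW r0 WP]]] := law_stable schi (open_nbhs_nbhs (conj oU Uchi)).
have /choice[i iW] (x : X) : exists i, W (q i - x).
  by apply: (qd x [set y | W (y - x)]); apply/group_nbhs0P; apply: filterS nW => y /=;
    rewrite addrAC subrr add0r.
have [mc [s chis]] := schi.
pose psi t := q (i (chi t)).
have spsi : simple_rv psi.
  split=> [B|]; first exact: (mc [set x | B (q (i x))]).
  by exists [seq q (i x) | x <- s] => t; apply: (map_f (fun x => q (i x)) (chis t)).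
have mpsi := simple_measurable spsi.
exists (law (unif R) mpsi); split.
  apply: WP; exists set0; first by rewrite pr0 ltW.
  by move=> t _; exact: iW.
have [j Fj] := Fq (map i s).
have psiF t : psi t \in F j by rewrite Fj; exact: (map_f q (map_f i (chis t))).
pose H : set X := [set y | exists2 a, a \in F j & interior (V (n j)) (y - a)].
have oH : open H.
  rewrite openE => y [a Fa] /nbhs_interior/group_nbhs0P nV.
  apply/group_nbhs0P; apply: filterS nV => z Vz; exists a => //.
  by move: Vz; rewrite /= (_ : y - a + z = y + z - a)//; zmod.
have [|||h [hc h01 h1 h0]] := @separating_function R X hX [set x | x \in F j] (~` H).
- have := @closed_seq_union X X (F j) (fun a => [set a]).
  rewrite (_ : [set y | _] = [set x | x \in F j]); last first.
    by apply/seteqP; split=> [x [a Fa ->]//|x Fx]; exists x.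
  apply=> a; apply: accessible_closed_set1; apply: hausdorff_accessible.
  exact: polish_hausdorff hX.
- exact: open_closedC.
- move=> x Fx; apply; exists x => //; rewrite subrr.
  exact: (base_nbhs bV).
have [|b bE] := @make_bounded_continuous R X h 1 hc.
  by move=> x; have := h01 x; rewrite ler_norml; lra.
exists j, b; rewrite bE; split=> //.
  by move=> x nF; apply: h0 => -[a Fa /interior_subset Va]; apply: nF; exists a.
rewrite -bE integral_law.
have : pr (unif R) setT <= \int[unif R]_t sval b (psi t).
  by apply: pr_le_integral => //; rewrite bE// => t _; apply: h1; exact: psiF.
rewrite prT; apply: lt_le_trans.
by rewrite ltrBlDr ltrDl.
Qed.

End concentration.

Lemma closed_nowhere_dense_dense (T : topologicalType) (A : set T) :
  nowhere_dense A -> open (~` closure A) /\ dense (~` closure A).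
Proof.
move=> nA; split; first by apply: closed_openC; exact: closed_closure.
move=> U [x Ux] oU; apply: contrapT => h.
suff : interior (closure A) x by rewrite nA.
apply: filterS (open_nbhs_nbhs (conj oU Ux)) => y Uy.
by apply: contrapT => cy; apply: h; exists y.
Qed.

Section existence.
Variables (R : realType) (X : topologicalZmodType).
Hypotheses (hX : polish R X) (nlc : ~ locally_compact [set: X]).

Lemma uncovered_base : exists2 V : nat -> set X, group_base V &
  forall n, ~ covered (V n) (V n.+1).
Proof.
apply: (group_base_refined (Q := fun U W => ~ covered U W) hX) => U nU.
have [W nW UW] := not_locally_compact_covered hX nlc nU; exists W => // W' _ W'W.
move=> [s sP]; apply: UW; exists s => y /sP[a sa Wa]; exists a => //.
exact: W'W.
Qed.

(** Since no neighbourhood of 0 is covered by finitely many translates of the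
    next one, the shifts can be chosen one after the other. *)
Lemma apart_sequence (V : nat -> set X) (F : nat -> seq X) (D : seq X) k :
  ~ covered (V k) (V k.+1) ->
  exists g : nat -> X, (forall j, V k (g j)) /\
    forall i j a a' d, (i < j)%N -> a \in F i -> a' \in F j -> d \in D ->
      ~ V k.+1 (g j - (g i + a - a' + d)).
Proof.
move=> ncov.
pose Q (s : seq X) (y : X) := V k y /\ forall i a a' d, (i < size s)%N ->
  a \in F i -> a' \in F (size s) -> d \in D -> ~ V k.+1 (y - (s`_i + a - a' + d)).
have [|g gQ] := @history_choice X Q.
  move=> s; apply: contrapT => none; apply: ncov.
  exists [seq x | x <- flatten [seq [seq s`_i + p.1 - p.2 + d |
    p <- [seq (a, a') | a <- F i, a' <- F (size s)], d <- D] | i <- iota 0 (size s)]].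
  move=> y Vy; apply: contrapT => nc; apply: none; exists y; split=> //.
  move=> i a a' d si Fa Fa' Dd Vd; apply: nc; exists (s`_i + a - a' + d) => //.
  rewrite map_id; apply/flattenP; eexists.
    by apply/mapP; exists i; [rewrite mem_iota add0n|reflexivity].
  by apply/allpairsP; exists ((a, a'), d); split=> //=; apply/allpairsP; exists (a, a').
exists g; split=> [j|i j a a' d ij Fa Fa' Dd]; first by have [] := gQ j.
have [_ h] := gQ j; have := h i a a' d.
by rewrite size_mkseq nth_mkseq//; apply.
Qed.

Lemma exists_closed_weakly_haar_null :
  exists A : set X, closed A /\ weakly_haar_null R A.
Proof.
have [V bV ncov] := uncovered_base.
have [q qd] := dense_sequence hX.
pose F j : seq X := if unpickle j is Some l then map q (l : seq nat) else [::].
have Fq (l : seq nat) : exists j, F j = map q l.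
  by exists (pickle l); rewrite /F pickleK.
have nVS n : ~ (V n `<=` V n.+1).
  move=> h; apply: (ncov n); exists [:: 0] => y /h Vy; exists 0; first exact: mem_head.
  by rewrite subr0.
have [f [mf f_finite f_spread]] := spread_rv hX bV nVS.
have /choice[D0 D0P] := f_finite.
pose D k := 0 :: D0 (k + 5)%N.
have /choice[N NP] (p : nat * nat) : exists N,
    (size (F p.2))%:R * (2 * (2^-1 : R) ^+ N) <= 2^-1 ^+ p.1.
  have [|N N_small] := @exprV2_small R (2^-1 ^+ p.1 / (2 * (size (F p.2)).+1%:R)).
    by rewrite divr_gt0 ?exprn_gt0 ?invr_gt0// mulr_gt0// ltr0n.
  exists N; move: N_small; rewrite ler_pdivlMr ?mulr_gt0 ?ltr0n//.
  set x := 2^-1 ^+ N; have x0 : 0 <= x by rewrite exprn_ge0 ?invr_ge0.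
  by rewrite -natr1 => Nx; lra.
(* the scale depends on the size of F j, which enters the mass estimate *)
pose m k j := maxn (k + 5) (4 * N (k, j)).+1.
have /choice[g gP] k := @apart_sequence V F (D k) k.+2 (ncov k.+2).
have m_ge k j : (k + 5 <= m k j)%N by exact: leq_maxl.
have D_0 k : 0 \in D k by exact: mem_head.
have g_small k j : V k.+2 (g k j) by have [] := gP k.
have g_apart k := (gP k).2.
pose A := coded V F m g.
have cA : closed A by exact: (closed_coded bV m_ge D_0 g_apart).
have wA : @witness_measures R X A (law (unif R) mf).
  apply: (spread_witness bV m_ge D_0 g_apart).
    move=> k t t'; have [d Dd Vd] := D0P (k + 5)%N t t'.
    by exists d; rewrite // inE Dd orbT.
  move=> k j; exists (2 * 2^-1 ^+ N (k, j)); split; last exact: (NP (k, j)).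
  move=> c; apply: le_trans (spread_mass bV c mf (f_spread (N (k, j)))).
  apply: pr_le; [exact: measurable_near|exact: measurable_near|].
  by move=> t; apply: (base_mono bV); exact: leq_maxr.
exists A; split=> //; split; first exact: closed_analytic.
  split; first exact: closed_universally_measurable.
  by exists (law (unif R) mf).
move=> [E nE EA].
pose G k := concentrated V F (fun j => (m k j).+1) ((2^-1 : R) ^+ k.+2).
have e0 k : 0 < (2^-1 : R) ^+ k.+2 by rewrite exprn_gt0 ?invr_gt0.
(* the two countable families of dense open sets are interleaved *)
pose O n := if odd n then G n./2 else ~` closure (E n./2).
have [||mu muO] := @borel_prob_baire R X hX O.
- move=> n; rewrite /O; case: ifP => _; first exact: open_concentrated.
  by have [] := closed_nowhere_dense_dense (nE n./2).
- move=> n; rewrite /O; case: ifP => _; last by have [] := closed_nowhere_dense_dense (nE n./2).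
  exact: (dense_concentrated hX bV _ (e0 _) qd).
have muG k : G k mu by have := muO k.*2.+1; rewrite /O /= odd_double /= uphalf_double.
have muE k : ~ closure (E k) mu by have := muO k.*2; rewrite /O odd_double doubleK.
have /choice[J JP] k := concentratedP bV (muG k).
apply: (concentrated_not_witness hX bV m_ge D_0 g_small g_apart JP).
apply: contrapT => nw; have : (~` @witness_measures R X A) mu by [].
by rewrite EA => -[k _ /subset_closure]; exact: muE.
Qed.

End existence.

Theorem theoremC (R : realType) (X : topologicalZmodType) (hX : polish R X) :
  ~ locally_compact [set: X] <->
  exists A : set X, closed A /\ weakly_haar_null R A.
Proof.
split; first exact: exists_closed_weakly_haar_null.
move=> [A [cA [_ hA nA]]] lc; apply: nA.
exact: locally_compact_comeager.
Qed.
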